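(* Let $\alpha\in(0,0.3738)$ and $\beta\in(1,2)$, and assume the temporal stepsize $\tau$ and spatial stepsize $h$ are sufficiently small. Then the two-dimensional L1-2 scheme in the context is numerically stable and its solution satisfies $$\|\mathbf U^n\|_{L^2_h}\le\|\mathbf U^0\|_{L^2_h}+C^{(\alpha)}\max_{1\le k\le n}\big\{(k\tau)^{\alpha}\|\mathbf F^k\|_{L^2_h}\big\},\qquad 1\le n\le N,$$ where $C^{(\alpha)}=\max\Big\{\frac{6\Gamma(1-\alpha)}{\tilde a^{\alpha}},\frac{3\Gamma(2-\alpha)}{\alpha\tilde a^{\alpha}}\Big\}$.
   Context: Time grid: $\tilde a>0$, $T>\tilde a$, $N\in\mathbb{Z}^+$, $\tau=(T-\tilde a)/N$, $t_k=\tilde a+k\tau$. L1-2 coefficients: $a^{(\alpha)}_{i,k}=(\log\frac{t_k}{t_{i-1}})^{1-\alpha}-(\log\frac{t_k}{t_i})^{1-\alpha}$; for $i\ge2$, $b^{(\alpha)}_{i,k}=\frac{1}{\log\frac{t_i}{t_{i-2}}}\{\log\frac{t_i}{t_{i-1}}[(\log\frac{t_k}{t_i})^{1-\alpha}+(\log\frac{t_k}{t_{i-1}})^{1-\alpha}]+\frac{2}{2-\alpha}[(\log\frac{t_k}{t_i})^{2-\alpha}-(\log\frac{t_k}{t_{i-1}})^{2-\alpha}]\}$; $c^{(\alpha)}_{1,1}=\frac{a^{(\alpha)}_{1,1}}{\Gamma(2-\alpha)\log\frac{t_1}{t_0}}$; for $k\ge2$: $c^{(\alpha)}_{1,k}=\frac{a^{(\alpha)}_{1,k}+b^{(\alpha)}_{2,k}}{\Gamma(2-\alpha)\log\frac{t_1}{t_0}}$,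 $c^{(\alpha)}_{i,k}=\frac{a^{(\alpha)}_{i,k}-b^{(\alpha)}_{i,k}+b^{(\alpha)}_{i+1,k}}{\Gamma(2-\alpha)\log\frac{t_i}{t_{i-1}}}$ ($2\le i\le k-1$), $c^{(\alpha)}_{k,k}=\frac{a^{(\alpha)}_{k,k}-b^{(\alpha)}_{k,k}}{\Gamma(2-\alpha)\log\frac{t_k}{t_{k-1}}}$. Space grid: $L>0$, $M\in\mathbb{Z}^+$, $h=2L/M$, $x_j=-L+jh$, $y_k=-L+kh$; grid functions are $0$ unless $1\le j,k\le M-1$; $(w,v)_{h^2}=h^2\sum_{j,k=1}^{M-1}w_{jk}v_{jk}$, $\|w\|^2_{L^2_h}=(w,w)_{h^2}$; $((-\Delta_h)^{\beta/2}w)_{jk}=h^{-\beta}\sum_{l,m\in\mathbb{Z}}a^{(\beta)}_{l,m}w_{j+l,k+m}$, $a^{(\beta)}_{l,m}=\frac{1}{4\pi^2}\int_{-\pi}^{\pi}\int_{-\pi}^{\pi}[4\sin^2\frac{\eta_1}{2}+4\sin^2\frac{\eta_2}{2}]^{\beta/2}e^{-\mathbf{i}(\eta_1l+\eta_2m)}d\eta_1d\eta_2$. Scheme (with $\mathbf F^n=(f(x_j,y_k,t_n))_{j,k}$, $\mathbf U^n=(U^n_{jk})$): $c^{(\alpha)}_{1,1}U^1_{jk}-c^{(\alpha)}_{1,1}U^0_{jk}+((-\Delta_h)^{\beta/2}U^1)_{jk}=f(x_j,y_k,t_1)$; for $2\le n\le N$: $c^{(\alpha)}_{n,n}U^n_{jk}+\sum_{i=1}^{n-1}(c^{(\alpha)}_{i,n}-c^{(\alpha)}_{i+1,n})U^i_{jk}-c^{(\alpha)}_{1,n}U^0_{jk}+((-\Delta_h)^{\beta/2}U^n)_{jk}=f(x_j,y_k,t_n)$;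 for $1\le j,k\le M-1$; $U^0_{jk}=u_0(x_j,y_k)$; $U^n_{jk}=0$ at boundary grid points. *)

(* Defs.v *)
From Stdlib Require Import Reals.
From Coquelicot Require Import Coquelicot.
Open Scope R_scope.

(* real power with the convention 0^y = 0 (used only for bases >= 0, y > 0) *)
Definition rpow (x y : R) : R := if Rle_dec x 0 then 0 else Rpower x y.

Definition Gamma (s : R) : R :=
  RInt_gen (fun t => Rpower t (s - 1) * exp (- t)) (at_right 0) (Rbar_locally p_infty).

Definition tgrid (a T : R) (N k : nat) : R := a + INR k * ((T - a) / INR N).

Section L12.
Variables (al a T : R) (N : nat).
Let t := tgrid a T N.

Definition a_coef (i k : nat) : R :=
  rpow (ln (t k / t (i - 1)%nat)) (1 - al) - rpow (ln (t k / t i)) (1 - al).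

Definition b_coef (i k : nat) : R :=
  / ln (t i / t (i - 2)%nat) *
  ( ln (t i / t (i - 1)%nat) *
      (rpow (ln (t k / t i)) (1 - al) + rpow (ln (t k / t (i - 1)%nat)) (1 - al))
    + 2 / (2 - al) *
      (rpow (ln (t k / t i)) (2 - al) - rpow (ln (t k / t (i - 1)%nat)) (2 - al)) ).

(* c^{(al)}_{i,k} for 1 <= i <= k *)
Definition c_coef (i k : nat) : R :=
  if (k =? 1)%nat then a_coef 1 1 / (Gamma (2 - al) * ln (t 1%nat / t 0%nat))
  else if (i =? 1)%nat then
    (a_coef 1 k + b_coef 2 k) / (Gamma (2 - al) * ln (t 1%nat / t 0%nat))
  else if (i =? k)%nat then
    (a_coef k k - b_coef k k) / (Gamma (2 - al) * ln (t k / t (k - 1)%nat))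
  else
    (a_coef i k - b_coef i k + b_coef (S i) k) / (Gamma (2 - al) * ln (t i / t (i - 1)%nat)).
End L12.

Definition sum_int (M : nat) (F : nat -> R) : R :=
  sum_f_R0 (fun i => F (S i)) (M - 2) * (if (2 <=? M)%nat then 1 else 0).

Definition inner_h (h : R) (M : nat) (w v : nat -> nat -> R) : R :=
  h ^ 2 * sum_int M (fun j => sum_int M (fun k => w j k * v j k)).
Definition norm_h (h : R) (M : nat) (w : nat -> nat -> R) : R :=
  sqrt (inner_h h M w w).

(* a^{(beta)}_{l,m} = 1/(4 pi^2) int int [4 sin^2(e1/2) + 4 sin^2(e2/2)]^{beta/2}
   e^{-i(e1 l + e2 m)}; the imaginary part vanishes by symmetry, so this is
   the real part written with cos. *)
Definition frac_coef (be : R) (l m : Z) : R :=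
  / (4 * PI ^ 2) *
  RInt (fun e1 => RInt (fun e2 =>
      rpow (4 * sin (e1 / 2) ^ 2 + 4 * sin (e2 / 2) ^ 2) (be / 2)
      * cos (e1 * IZR l + e2 * IZR m)) (- PI) PI) (- PI) PI.

(* ((-Delta_h)^{beta/2} w)_{jk}; w is extended by zero outside 1..M-1, so the
   bi-infinite sum reduces to the interior points. *)
Definition frac_lap (be h : R) (M : nat) (w : nat -> nat -> R) (j k : nat) : R :=
  / Rpower h be *
  sum_int M (fun j' => sum_int M (fun k' =>
     frac_coef be (Z.of_nat j' - Z.of_nat j)%Z (Z.of_nat k' - Z.of_nat k)%Z * w j' k')).

Definition is_L12_solution (al be a T L : R) (N M : nat)
   (f : R -> R -> R -> R) (u0 : R -> R -> R) (U : nat -> nat -> nat -> R) : Prop :=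
  let h := 2 * L / INR M in
  let x := fun j : nat => - L + INR j * h in
  let t := tgrid a T N in
  let c := c_coef al a T N in
  (forall j k, (1 <= j <= M - 1)%nat -> (1 <= k <= M - 1)%nat ->
     U 0%nat j k = u0 (x j) (x k)) /\
  (forall n j k, (1 <= n <= N)%nat -> (j = 0 \/ j = M \/ k = 0 \/ k = M)%nat ->
     U n j k = 0) /\
  (forall j k, (1 <= j <= M - 1)%nat -> (1 <= k <= M - 1)%nat ->
     c 1%nat 1%nat * U 1%nat j k - c 1%nat 1%nat * U 0%nat j k
     + frac_lap be h M (U 1%nat) j k = f (x j) (x k) (t 1%nat)) /\
  (forall n j k, (2 <= n <= N)%nat ->
     (1 <= j <= M - 1)%nat -> (1 <= k <= M - 1)%nat ->
     c n n * U n j k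
     + sum_f_R0 (fun i0 => let i := S i0 in (c i n - c (S i) n) * U i j k) (n - 2)
     - c 1%nat n * U 0%nat j k
     + frac_lap be h M (U n) j k = f (x j) (x k) (t n)).

(* Main.v *)
Require Import Defs.
From Stdlib Require Import Reals List Lra Lia Arith Classical.
From Coquelicot Require Import Coquelicot.
Open Scope R_scope.

(** In the variable [log t] the scheme has nonincreasing steps [d_i] and coefficients
    [Gamma(2-al) c_(i,k) = (a_i + B_i - B_(i+1)) / d_i] with [B = -b >= 0]. Testing the scheme with
    [U^n], positive semidefiniteness of the discrete fractional Laplacian and Cauchy-Schwarz give the
    bound by induction, once [0 < c_(1,k) <= ... <= c_(k,k)] and [1 / c_(1,k) <= C (k tau)^al] hold.
    For [tau] small consecutive steps are almost equal. Monotonicity then follows from convexity of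
    [x^(-al)] and [B <= al (1-al) x^(-al-1) d^3 / 6 / (d_i + d_(i-1))], except for the one comparison
    [c_(k-2,k) <= c_(k-1,k)], where these bounds are too weak; there the gap is a continuous
    function of the step ratios, and on a uniform grid it has the sign of
    [(36-6al) 2^(-al) - (24-3al) 3^(-al) - (12-3al)], positive exactly up to [al = 0.37386...]. *)

(** * Weights of the L1-2 formula *)

(** What singles out the last steps is distance. With [x] the logarithmic distance from [t_k] back
    to [t_i], the bound on [B_i] carries [x^(-al-1)] and is void at [x = 0], which is where [B_k]
    sits. In [c_(k-1,k) <= c_(k,k)] this is harmless, since [B_k] lowers the left side and raises
    the right one. In [c_(k-2,k) <= c_(k-1,k)] it lowers the right side, and near the critical [al]
    no slack is left to absorb a rough estimate. In all comparisons but this one the shared term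
    [B_(i+1)] can be discarded. Convexity yields a gap of at least [al (1-al) d Z], with [Z] the
    power [-al-1] of the farthest distance involved, and the harmful corrections [B_i] and [B_(i+2)]
    are bounded by fractions of that same quantity that add up to less than 1 as soon as step ratios
    stay below 1.01. The exceptional gap is homogeneous in the steps, so continuity at one point,
    all ratios equal to 1, gives a tolerance [eps] depending on [al] alone; the threshold on [tau]
    then depends only on [al] and [a]. *)

Lemma nonneg_of_derive (f f' : R -> R) :
  (forall t, 0 <= t -> is_derive f t (f' t)) ->
  (forall t, 0 <= t -> 0 <= f' t) -> 0 <= f 0 ->
  forall t, 0 <= t -> 0 <= f t.
Proof.
  intros Hd Hp H0 t Ht.
  destruct (Req_dec t 0) as [->|Hn]; [exact H0|].
  destruct (MVT_gen f 0 t f') as [c [Hc E]].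
  - intros x Hx. rewrite Rmin_left in Hx by lra. apply Hd; lra.
  - intros x Hx. rewrite Rmin_left in Hx by lra.
    apply continuity_pt_filterlim.
    apply (ex_derive_continuous f). exists (f' x). apply Hd; lra.
  - rewrite Rmin_left in Hc by lra.
    assert (0 <= f' c) by (apply Hp; lra). nra.
Qed.

Lemma is_derive_Rpower (y x : R) :
  0 < x -> is_derive (fun t => Rpower t y) x (y * Rpower x (y - 1)).
Proof. intros Hx. apply is_derive_Reals. now apply derivable_pt_lim_power. Qed.

Lemma Derive_Rpower (y x : R) : 0 < x -> Derive (fun t : R => Rpower t y) x = y * Rpower x (y - 1).
Proof. intros Hx. apply is_derive_unique. now apply is_derive_Rpower. Qed.

Lemma Rpower_pos (x y : R) : 0 < Rpower x y.
Proof. apply exp_pos. Qed.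

Lemma Rpower_decr (x y p : R) : 0 < x -> x <= y -> p <= 0 -> Rpower y p <= Rpower x p.
Proof.
  intros Hx Hy Hp. unfold Rpower.
  destruct (Req_dec (p * ln y) (p * ln x)) as [->|Hn]; [lra|].
  left. apply exp_increasing.
  assert (ln x <= ln y) by (destruct (Req_dec x y) as [->|]; [lra|left; apply ln_increasing; lra]).
  nra.
Qed.

Lemma Rpower_succ (x y : R) : 0 < x -> Rpower x (y + 1) = Rpower x y * x.
Proof. intros Hx. rewrite Rpower_plus, Rpower_1; auto. Qed.

Lemma rpow_pos_base (x y : R) : 0 < x -> rpow x y = Rpower x y.
Proof. intros Hx. unfold rpow. destruct (Rle_dec x 0); lra. Qed.

Lemma rpow_zero (y : R) : rpow 0 y = 0.
Proof. unfold rpow. destruct (Rle_dec 0 0); lra. Qed.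

Definition Wa (al x d : R) : R := rpow (x + d) (1 - al) - rpow x (1 - al).

(** Twice the error (integral minus trapezoidal rule) for [u^(1-al)] on [[x, x+d]]. Up to the factor
    [d_i + d_(i-1)] it is [-b_(i,k)]. *)
Definition Wb (al x d : R) : R :=
  2 / (2 - al) * (rpow (x + d) (2 - al) - rpow x (2 - al))
  - d * (rpow x (1 - al) + rpow (x + d) (1 - al)).

Section Weights.
Variable al : R.
Hypothesis Hal : 0 < al < 1.

Let two_sub_one : 2 - al - 1 = 1 - al. Proof. ring. Qed.
Let one_sub_one : 1 - al - 1 = - al. Proof. ring. Qed.

Lemma Wb_derive (x d : R) : 0 < x -> 0 <= d ->
  is_derive (fun d => 2 / (2 - al) * (Rpower (x + 1 * d) (2 - al) - Rpower x (2 - al))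
     - d * (Rpower x (1 - al) + Rpower (x + 1 * d) (1 - al))) d
   (Rpower (x + 1 * d) (1 - al) - Rpower x (1 - al)
    - d * ((1 - al) * Rpower (x + 1 * d) (- al))).
Proof.
  intros Hx Hd.
  assert (D1 := is_derive_Rpower (2 - al) (x + 1 * d) ltac:(lra)).
  assert (D2 := is_derive_Rpower (1 - al) (x + 1 * d) ltac:(lra)).
  replace (2 - al - 1) with (1 - al) in D1 by ring.
  replace (1 - al - 1) with (- al) in D2 by ring.
  auto_derive.
  - split; [eexists; exact D1|split; [eexists; exact D2|exact I]].
  - rewrite 2!Derive_Rpower by nra. rewrite ?two_sub_one, ?one_sub_one. field. lra.
Qed.

Lemma Wb_derive2 (x d : R) : 0 < x -> 0 <= d ->
  is_derive (fun d => Rpower (x + 1 * d) (1 - al) - Rpower x (1 - al)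
    - d * ((1 - al) * Rpower (x + 1 * d) (- al))) d
   (d * (al * (1 - al) * Rpower (x + 1 * d) (- al - 1))).
Proof.
  intros Hx Hd.
  assert (D1 := is_derive_Rpower (- al) (x + 1 * d) ltac:(lra)).
  assert (D2 := is_derive_Rpower (1 - al) (x + 1 * d) ltac:(lra)).
  replace (1 - al - 1) with (- al) in D2 by ring.
  auto_derive.
  - split; [eexists; exact D2|split; [eexists; exact D1|exact I]].
  - rewrite 2!Derive_Rpower by nra. rewrite ?two_sub_one, ?one_sub_one. ring.
Qed.

(** The trapezoidal rule underestimates a concave function, with the usual cubic error. In [d], the
    function and its first derivative vanish at 0, and the second derivative lies between 0 and
    [K d] because [(x+d)^(-al-1) <= x^(-al-1)]; integrating twice gives both bounds. *)
Lemma Wb_bounds (x d : R) : 0 < x -> 0 <= d ->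
  0 <= Wb al x d <= al * (1 - al) * Rpower x (- al - 1) * d ^ 3 / 6.
Proof.
  intros Hx Hd. unfold Wb. rewrite !rpow_pos_base by lra.
  set (K := al * (1 - al) * Rpower x (- al - 1)).
  set (g := fun d => Rpower (x + 1 * d) (1 - al) - Rpower x (1 - al)
    - d * ((1 - al) * Rpower (x + 1 * d) (- al))).
  set (f := fun d => 2 / (2 - al) * (Rpower (x + 1 * d) (2 - al) - Rpower x (2 - al))
     - d * (Rpower x (1 - al) + Rpower (x + 1 * d) (1 - al))).
  assert (Hg0 : g 0 = 0) by (unfold g; replace (x + 1 * 0) with x by ring; ring).
  assert (Hf0 : f 0 = 0) by (unfold f; replace (x + 1 * 0) with x by ring; ring).
  assert (Ha : 0 < al * (1 - al)) by nra.
  assert (Hg : forall t, 0 <= t -> 0 <= g t).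
  { apply (nonneg_of_derive g _ (fun t Ht => Wb_derive2 x t Hx Ht)); [|lra].
    intros t Ht. assert (P := Rpower_pos (x + 1 * t) (- al - 1)).
    apply Rmult_le_pos; [lra|]. apply Rmult_le_pos; lra. }
  assert (Hg' : forall t, 0 <= t -> 0 <= K * t ^ 2 / 2 - g t).
  { apply (nonneg_of_derive (fun t => K * t ^ 2 / 2 - g t)
      (fun t => K * t - (t * (al * (1 - al) * Rpower (x + 1 * t) (- al - 1))))).
    - intros t Ht. apply (is_derive_minus (fun t => K * t ^ 2 / 2) g).
      + auto_derive; [exact I|field].
      + now apply Wb_derive2.
    - intros t Ht.
      assert (P := Rpower_decr x (x + 1 * t) (- al - 1) Hx ltac:(lra) ltac:(lra)).
      unfold K.
      replace (al * (1 - al) * Rpower x (- al - 1) * t -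
        t * (al * (1 - al) * Rpower (x + 1 * t) (- al - 1))) with
       (al * (1 - al) * t * (Rpower x (- al - 1) - Rpower (x + 1 * t) (- al - 1))) by ring.
      apply Rmult_le_pos; [|lra]. apply Rmult_le_pos; lra.
    - rewrite Hg0. lra. }
  replace (x + d) with (x + 1 * d) by ring. fold (f d). split.
  - apply (nonneg_of_derive f g (fun t Ht => Wb_derive x t Hx Ht)); auto; lra.
  - assert (0 <= K * d ^ 3 / 6 - f d); [|lra].
    apply (nonneg_of_derive (fun t => K * t ^ 3 / 6 - f t) (fun t => K * t ^ 2 / 2 - g t));
      auto; [|rewrite Hf0; lra].
    intros t Ht. apply (is_derive_minus (fun t => K * t ^ 3 / 6) f).
    + auto_derive; [exact I|field].
    + now apply Wb_derive.
Qed.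

Lemma Wb_zero (d : R) : 0 < d -> Wb al 0 d = al / (2 - al) * Rpower d (2 - al).
Proof.
  intros Hd. unfold Wb. rewrite !rpow_zero, !Rplus_0_l, !rpow_pos_base by lra.
  assert (E : Rpower d (2 - al) = Rpower d (1 - al) * d)
    by (rewrite <- Rpower_succ by lra; f_equal; ring).
  rewrite E.
  field. lra.
Qed.

Lemma Wb_nonneg (x d : R) : 0 <= x -> 0 < d -> 0 <= Wb al x d.
Proof.
  intros [Hx|<-] Hd.
  - now apply Wb_bounds; [|left].
  - rewrite Wb_zero by lra. apply Rmult_le_pos; [|left; apply Rpower_pos].
    apply Rdiv_le_0_compat; lra.
Qed.

Lemma Rpower_mvt (x y p : R) : 0 < x -> x < y ->
  exists z, x <= z <= y /\ Rpower y p - Rpower x p = p * Rpower z (p - 1) * (y - x).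
Proof.
  intros Hx Hy.
  destruct (MVT_gen (fun t => Rpower t p) x y (fun t => p * Rpower t (p - 1))) as [z [Hz E]].
  - intros t Ht. rewrite Rmin_left in Ht by lra. apply is_derive_Rpower; lra.
  - intros t Ht. rewrite Rmin_left in Ht by lra.
    apply continuity_pt_filterlim, (ex_derive_continuous (fun t => Rpower t p)).
    eexists. apply is_derive_Rpower; lra.
  - rewrite Rmin_left, Rmax_right in Hz by lra. exists z. split; [lra|exact E].
Qed.

Lemma Wa_mean_ge (x d : R) : 0 <= x -> 0 < d -> (1 - al) * Rpower (x + d) (- al) <= Wa al x d / d.
Proof.
  intros Hx Hd. apply (proj1 (Rle_div_r _ _ _ Hd)).
  unfold Wa. rewrite (rpow_pos_base (x + d)) by lra.
  destruct Hx as [Hx|<-].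
  - rewrite rpow_pos_base by lra.
    destruct (Rpower_mvt x (x + d) (1 - al)) as [z [Hz E]]; try lra.
    rewrite E. replace (1 - al - 1) with (- al) by ring.
    assert (P := Rpower_decr z (x + d) (- al) ltac:(lra) ltac:(lra) ltac:(lra)).
    replace (x + d - x) with d by ring.
    apply Rmult_le_compat_r; [lra|]. apply Rmult_le_compat_l; lra.
  - rewrite rpow_zero, Rplus_0_l.
    assert (E : Rpower d (1 - al) = Rpower d (- al) * d)
      by (rewrite <- Rpower_succ by lra; f_equal; ring).
    rewrite E.
    assert (P := Rmult_lt_0_compat _ _ (Rpower_pos d (- al)) Hd). nra.
Qed.

Lemma Wa_mean_le (x d : R) : 0 < x -> 0 < d -> Wa al x d / d <= (1 - al) * Rpower x (- al).
Proof.
  intros Hx Hd. apply (proj2 (Rle_div_l _ _ _ Hd)).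
  unfold Wa. rewrite !rpow_pos_base by lra.
  destruct (Rpower_mvt x (x + d) (1 - al)) as [z [Hz E]]; try lra.
  rewrite E. replace (1 - al - 1) with (- al) by ring.
  assert (P := Rpower_decr x z (- al) ltac:(lra) ltac:(lra) ltac:(lra)).
  replace (x + d - x) with d by ring.
  apply Rmult_le_compat_r; [lra|]. apply Rmult_le_compat_l; lra.
Qed.

(* Both means are compared at equal fractions of their intervals: the mean value theorem for
   [t |-> Wa(x, t d)/d - Wa(x+d, t e)/e] gives two points at distance at least [d]. *)
Lemma Wa_mean_diff (x d e : R) : 0 <= x -> 0 < d -> d <= e ->
  d * (al * (1 - al)) * Rpower (x + d + e) (- al - 1) <= Wa al x d / d - Wa al (x + d) e / e.
Proof.
  intros [Hx|<-] Hd He.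
  - set (f := fun t => Rpower (x + d * t) (1 - al) / d - Rpower ((x + d) + e * t) (1 - al) / e).
    set (f' := fun t => (1 - al) * Rpower (x + d * t) (- al)
                 - (1 - al) * Rpower ((x + d) + e * t) (- al)).
    assert (D : forall t, 0 <= t -> is_derive f t (f' t)).
    { intros t Ht.
      assert (D1 := is_derive_Rpower (1 - al) (x + d * t) ltac:(nra)).
      assert (D2 := is_derive_Rpower (1 - al) (x + d + e * t) ltac:(nra)).
      replace (1 - al - 1) with (- al) in D1, D2 by ring.
      unfold f, f'. auto_derive.
      - split; [eexists; exact D1|split; [eexists; exact D2|exact I]].
      - rewrite 2!Derive_Rpower by nra. rewrite ?two_sub_one, ?one_sub_one. field. lra. }
    destruct (MVT_gen f 0 1 f') as [t [Ht E]].
    + intros t Ht. rewrite Rmin_left in Ht by lra. apply D; lra.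
    + intros t Ht. rewrite Rmin_left in Ht by lra.
      apply continuity_pt_filterlim, (ex_derive_continuous f). eexists; apply D; lra.
    + rewrite Rmin_left, Rmax_right in Ht by lra.
      assert (E' : Wa al x d / d - Wa al (x + d) e / e = f' t).
      { unfold Wa. rewrite !rpow_pos_base by lra. unfold f in E.
        replace (x + d * 1) with (x + d) in E by ring.
        replace (x + d + e * 1) with (x + d + e) in E by ring.
        replace (x + d * 0) with x in E by ring.
        replace (x + d + e * 0) with (x + d) in E by ring.
        replace (f' t) with (f' t * (1 - 0)) by ring. rewrite <- E. field. lra. }
      rewrite E'. unfold f'.
      assert (H1 : 0 < x + d * t) by nra.
      assert (H2 : d <= (x + d + e * t) - (x + d * t)) by nra.
      destruct (Rpower_mvt (x + d * t) (x + d + e * t) (- al)) as [z [Hz Ez]]; try lra.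
      assert (P := Rpower_decr z (x + d + e) (- al - 1) ltac:(lra) ltac:(nra) ltac:(lra)).
      assert (Q := Rpower_pos (x + d + e) (- al - 1)).
      replace ((1 - al) * Rpower (x + d * t) (- al) - (1 - al) * Rpower (x + d + e * t) (- al))
        with ((1 - al) * al * (Rpower z (- al - 1) * (x + d + e * t - (x + d * t))))
        by (rewrite <- Rmult_minus_distr_l;
            replace (Rpower (x + d * t) (- al) - Rpower (x + d + e * t) (- al)) with (- (Rpower (x + d + e * t) (- al) - Rpower (x + d * t) (- al))) by ring; rewrite Ez; ring).
      replace (d * (al * (1 - al)) * Rpower (x + d + e) (- al - 1))
        with ((1 - al) * al * (Rpower (x + d + e) (- al - 1) * d)) by ring.
      apply Rmult_le_compat_l; [nra|]. apply Rmult_le_compat; lra.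
  (* At [x = 0] the mean is exactly [d^(-al)], while the mean over the next interval is at most
     [(1-al) d^(-al)]. The difference [al d^(-al)] exceeds the claim, so no derivative at the
     singular endpoint is needed. *)
  - rewrite !Rplus_0_l.
    assert (E : Wa al 0 d / d = Rpower d (- al)).
    { unfold Wa. rewrite rpow_zero, Rplus_0_l, rpow_pos_base by lra.
      assert (E : Rpower d (1 - al) = Rpower d (- al) * d)
        by (rewrite <- Rpower_succ by lra; f_equal; ring).
      rewrite E. field. lra. }
    rewrite E. assert (H := Wa_mean_le d e Hd ltac:(lra)).
    assert (P := Rpower_decr d (d + e) (- al - 1) Hd ltac:(lra) ltac:(lra)).
    assert (Q : Rpower d (- al - 1) * d = Rpower d (- al)).
    { rewrite <- Rpower_succ by lra. f_equal; ring. }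
    assert (Q' := Rpower_pos d (- al)).
    assert (d * (al * (1 - al)) * Rpower (d + e) (- al - 1) <= al * (1 - al) * Rpower d (- al)).
    { rewrite <- Q. replace (d * (al * (1 - al)) * Rpower (d + e) (- al - 1))
       with (al * (1 - al) * (Rpower (d + e) (- al - 1) * d)) by ring.
      apply Rmult_le_compat_l; [nra|]. apply Rmult_le_compat_r; lra. }
    assert (al * (1 - al) * Rpower d (- al) <= al * Rpower d (- al)) by
      (apply Rmult_le_compat_r; nra).
    lra.
Qed.
End Weights.

(** * Positivity of the Gamma function *)

Section ImproperIntegral.
Variable f : R -> R.
Hypothesis f_cont : forall t, 0 < t -> continuous f t.
Hypothesis f_pos : forall t, 0 < t -> 0 < f t.

Lemma ex_RInt_pos_half_line (x y : R) : 0 < x -> x <= y -> ex_RInt f x y.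
Proof.
  intros Hx Hy. apply (ex_RInt_continuous (V := R_CompleteNormedModule)). intros t Ht.
  rewrite Rmin_left in Ht by lra. apply f_cont; lra.
Qed.

Lemma RInt_le_wider (x y x' y' : R) : 0 < x' -> x' <= x -> x <= y -> y <= y' ->
  RInt f x y <= RInt f x' y'.
Proof.
  intros H0 H1 H2 H3.
  assert (E1 := ex_RInt_pos_half_line x' x ltac:(lra) ltac:(lra)).
  assert (E2 := ex_RInt_pos_half_line x y ltac:(lra) ltac:(lra)).
  assert (E3 := ex_RInt_pos_half_line y y' ltac:(lra) ltac:(lra)).
  assert (P1 : 0 <= RInt f x' x).
  { apply RInt_ge_0; auto. intros t Ht; left; apply f_pos; lra. }
  assert (P3 : 0 <= RInt f y y').
  { apply RInt_ge_0; auto. intros t Ht; left; apply f_pos; lra. }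
  assert (C1 := RInt_Chasles f x' x y E1 E2).
  assert (C2 := RInt_Chasles f x' y y' (ex_RInt_Chasles _ _ _ _ E1 E2) E3).
  unfold plus in C1, C2; simpl in C1, C2. lra.
Qed.

(** The value of [RInt_gen] says nothing until convergence is established. For a positive integrand
    the integrals grow with the window, so bounded ones converge to their supremum, which is at
    least the positive integral over [[1, 2]]. *)
Lemma RInt_gen_pos (K : R) :
  (forall x y, 0 < x -> x <= y -> RInt f x y <= K) ->
  0 < RInt_gen f (at_right 0) (Rbar_locally p_infty).
Proof.
  intros HK.
  destruct (completeness (fun v => exists x y, 0 < x /\ x <= y /\ v = RInt f x y)) as [l [Hub Hlub]].
  - exists K. intros v [x [y [Hx [Hy ->]]]]. now apply HK.
  - exists (RInt f 1 2), 1, 2. repeat split; lra.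
  - assert (Hl : 0 < l).
    { apply Rlt_le_trans with (RInt f 1 2).
      - apply RInt_gt_0; [lra| |]; intros t Ht; [apply f_pos|apply f_cont]; lra.
      - apply Hub. exists 1, 2. repeat split; lra. }
    assert (HI : is_RInt_gen f (at_right 0) (Rbar_locally p_infty) l).
    { intros P [eps HP].
      destruct (classic (exists x y, 0 < x /\ x <= y /\ l - eps < RInt f x y))
        as [[x0 [y0 [Hx0 [Hy0 H]]]]|N].
      - exists (fun x => 0 < x < x0) (fun y => y0 < y).
        + exists (mkposreal x0 Hx0). intros x Hx Hx'. split; auto.
          unfold ball in Hx; simpl in Hx; unfold AbsRing_ball, abs, minus, plus, opp in Hx; simpl in Hx.
          rewrite Rabs_right in Hx; lra.
        + exists y0. auto.
        + intros x y Hx Hy. exists (RInt f x y). split.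
          * simpl. apply (RInt_correct f x y). apply ex_RInt_pos_half_line; lra.
          * apply HP. unfold ball; simpl; unfold AbsRing_ball, abs, minus, plus, opp; simpl.
            assert (RInt f x y <= l) by (apply Hub; exists x, y; repeat split; lra).
            assert (RInt f x0 y0 <= RInt f x y) by (apply RInt_le_wider; lra).
            apply Rabs_def1; destruct eps; simpl in *; lra.
      - exfalso. assert (l <= l - eps); [|destruct eps; simpl in *; lra].
        apply Hlub. intros v [x [y [Hx [Hy ->]]]].
        apply Rnot_lt_le. intros Hv. apply N. exists x, y; auto. }
    now rewrite (is_RInt_gen_unique _ _ HI).
Qed.
End ImproperIntegral.

Lemma Gamma_integrand_continuous (s t : R) : 0 < t ->
  continuous (fun t => Rpower t (s - 1) * exp (- t)) t.
Proof.
  intros Ht. apply (ex_derive_continuous (fun t => Rpower t (s - 1) * exp (- t))).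
  unfold Rpower. auto_derive. lra.
Qed.

(* The integrand is at most [(1 + t) e^(-t)], which has the antiderivative [-(t + 2) e^(-t)]. *)
Lemma Gamma_pos_1_2 (s : R) : 1 < s < 2 -> 0 < Gamma s.
Proof.
  intros Hs. unfold Gamma. apply RInt_gen_pos with 2.
  - intros t Ht. now apply Gamma_integrand_continuous.
  - intros t Ht. apply Rmult_lt_0_compat; apply exp_pos.
  - intros x y Hx Hy.
    assert (HD : is_RInt (fun t => (1 + t) * exp (- t)) x y
        (minus (- (y + 2) * exp (- y)) (- (x + 2) * exp (- x)))).
    { apply (is_RInt_derive (fun t => - (t + 2) * exp (- t))).
      - intros t _. auto_derive; [exact I|ring].
      - intros t _. apply (ex_derive_continuous (fun t => (1 + t) * exp (- t))).
        auto_derive; exact I. }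
    apply Rle_trans with (RInt (fun t => (1 + t) * exp (- t)) x y).
    + apply RInt_le; auto.
      * apply (ex_RInt_continuous (V := R_CompleteNormedModule)). intros t Ht. rewrite Rmin_left in Ht by lra.
        apply Gamma_integrand_continuous; lra.
      * eexists; exact HD.
      * intros t Ht. apply Rmult_le_compat_r; [left; apply exp_pos|].
        destruct (Rle_dec t 1).
        -- assert (Rpower t (s - 1) <= Rpower t 0).
           { unfold Rpower. assert (ln t <= 0) by (rewrite <- ln_1; apply ln_le; lra).
             destruct (Req_dec ((s - 1) * ln t) (0 * ln t)) as [->|]; [lra|].
             left; apply exp_increasing; nra. }
           rewrite Rpower_O in H by lra. lra.
        -- apply Rle_trans with (Rpower t 1); [|rewrite Rpower_1; lra].
           apply Rle_Rpower; lra.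
    + rewrite (is_RInt_unique _ _ _ _ HD). unfold minus, plus, opp; simpl.
      assert (0 < (y + 2) * exp (- y)) by (apply Rmult_lt_0_compat; [lra|apply exp_pos]).
      assert ((x + 2) * exp (- x) <= 2); [|lra].
      rewrite exp_Ropp. apply Rmult_le_reg_r with (exp x); [apply exp_pos|].
      assert (N := exp_pos x). rewrite Rmult_assoc, Rinv_l, Rmult_1_r by lra.
      assert (1 + x < exp x) by (apply exp_ineq1; lra). lra.
Qed.

(** * The discrete fractional Laplacian is positive semidefinite *)

Lemma sum_int_ext (M : nat) (F G : nat -> R) :
  (forall j, (1 <= j <= M - 1)%nat -> F j = G j) -> sum_int M F = sum_int M G.
Proof.
  intros H. unfold sum_int. destruct (Nat.leb_spec 2 M); [|ring].
  f_equal. apply sum_eq. intros i Hi. apply H. lia.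
Qed.

Lemma sum_int_plus (M : nat) (F G : nat -> R) :
  sum_int M (fun j => F j + G j) = sum_int M F + sum_int M G.
Proof. unfold sum_int. rewrite sum_plus. ring. Qed.

Lemma sum_int_scal (M : nat) (c : R) (F : nat -> R) :
  sum_int M (fun j => c * F j) = c * sum_int M F.
Proof.
  unfold sum_int. rewrite <- Rmult_assoc, scal_sum. f_equal.
  apply sum_eq. intros; ring.
Qed.

Lemma sum_int_nonneg (M : nat) (F : nat -> R) :
  (forall j, (1 <= j <= M - 1)%nat -> 0 <= F j) -> 0 <= sum_int M F.
Proof.
  intros H. unfold sum_int. destruct (Nat.leb_spec 2 M); [|lra].
  rewrite Rmult_1_r. 
  assert (G : forall n, (n <= M - 2)%nat -> 0 <= sum_f_R0 (fun i => F (S i)) n).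
  { induction n as [|n IH]; intros Hn; simpl.
    - apply H; lia.
    - apply Rplus_le_le_0_compat; [apply IH; lia|apply H; lia]. }
  now apply G.
Qed.

(** * Iterated integrals of jointly continuous functions over a square *)

Definition cont2 (g : R -> R -> R) : Prop := forall x y, continuity_2d_pt g x y.

Definition box_integral (a b : R) (g : R -> R -> R) : R :=
  RInt (fun x => RInt (fun y => g x y) a b) a b.

Lemma cont2_section (g : R -> R -> R) (x y : R) : cont2 g -> continuous (g x) y.
Proof.
  intros Hg. apply continuity_pt_filterlim. intros eps Heps.
  destruct (Hg x y (mkposreal eps Heps)) as [d Hd].
  exists d. split; [apply cond_pos|]. intros z [_ Hz].
  simpl. unfold R_dist in *. apply Hd; [|exact Hz].
  replace (x - x) with 0 by ring. rewrite Rabs_R0. apply cond_pos.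
Qed.

Section Box.
Variables a b : R.
Hypothesis Hab : a < b.

Lemma cont2_ex_RInt (g : R -> R -> R) (x : R) : cont2 g -> ex_RInt (g x) a b.
Proof.
  intros Hg. apply (ex_RInt_continuous (V := R_CompleteNormedModule)).
  intros y _. now apply cont2_section.
Qed.

(** Continuity is uniform along the compact segment [[a, b]], so the integrands at nearby [x] differ
    by at most [eps / (2 (b - a))] everywhere. This makes the outer integral exist. *)
Lemma cont2_RInt_continuous (g : R -> R -> R) (x : R) :
  cont2 g -> continuous (fun x => RInt (g x) a b) x.
Proof.
  intros Hg. apply continuity_pt_filterlim. intros eps Heps.
  assert (He : 0 < eps / (2 * (b - a))) by (apply Rdiv_lt_0_compat; lra).
  destruct (uniform_continuity_2d_1d' g a b x (fun y _ => Hg x y) (mkposreal _ He)) as [d Hd].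
  exists d. split; [apply cond_pos|]. intros z [_ Hz]. simpl in *. unfold R_dist in *.
  assert (Hz' := Rabs_def2 _ _ Hz). assert (Hp := cond_pos d).
  assert (E := RInt_minus (g z) (g x) a b (cont2_ex_RInt g z Hg) (cont2_ex_RInt g x Hg)).
  unfold minus, plus, opp in E; simpl in E. unfold Rminus. rewrite <- E.
  apply Rle_lt_trans with ((b - a) * (eps / (2 * (b - a)))).
  - apply abs_RInt_le_const; [lra| |].
    + apply (ex_RInt_minus (V := R_NormedModule)); now apply cont2_ex_RInt.
    + intros t Ht. left. apply (Hd t x t z); try lra.
      replace (t - t) with 0 by ring. rewrite Rabs_R0. exact Hp.
  - replace ((b - a) * (eps / (2 * (b - a)))) with (eps / 2) by (field; lra). lra.
Qed.

Lemma cont2_ex_RInt2 (g : R -> R -> R) : cont2 g -> ex_RInt (fun x => RInt (fun y => g x y) a b) a b.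
Proof.
  intros Hg. apply (ex_RInt_continuous (V := R_CompleteNormedModule)).
  intros x _. now apply cont2_RInt_continuous.
Qed.

Lemma cont2_plus (f g : R -> R -> R) : cont2 f -> cont2 g -> cont2 (fun x y => f x y + g x y).
Proof. intros Hf Hg x y. now apply continuity_2d_pt_plus. Qed.

Lemma cont2_mult (f g : R -> R -> R) : cont2 f -> cont2 g -> cont2 (fun x y => f x y * g x y).
Proof. intros Hf Hg x y. now apply continuity_2d_pt_mult. Qed.

Lemma cont2_const (c : R) : cont2 (fun _ _ => c).
Proof. intros x y. apply continuity_2d_pt_const. Qed.

Lemma box_integral_plus (f g : R -> R -> R) : cont2 f -> cont2 g ->
  box_integral a b (fun x y => f x y + g x y) = box_integral a b f + box_integral a b g.
Proof.
  intros Hf Hg. unfold box_integral.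
  etransitivity; [|exact (RInt_plus (V := R_CompleteNormedModule) _ _ a b
                (cont2_ex_RInt2 f Hf) (cont2_ex_RInt2 g Hg))].
  apply RInt_ext. intros x _.
  apply (RInt_plus (V := R_CompleteNormedModule) (f x) (g x) a b); now apply cont2_ex_RInt.
Qed.

Lemma box_integral_scal (c : R) (f : R -> R -> R) : cont2 f ->
  box_integral a b (fun x y => c * f x y) = c * box_integral a b f.
Proof.
  intros Hf. unfold box_integral.
  etransitivity; [|exact (RInt_scal (V := R_CompleteNormedModule) _ a b c (cont2_ex_RInt2 f Hf))].
  apply RInt_ext. intros x _.
  apply (RInt_scal (V := R_CompleteNormedModule) (f x) a b c); now apply cont2_ex_RInt.
Qed.

Lemma box_integral_nonneg (f : R -> R -> R) : cont2 f -> (forall x y, 0 <= f x y) ->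
  0 <= box_integral a b f.
Proof.
  intros Hf Hp. unfold box_integral. apply RInt_ge_0; [lra|now apply cont2_ex_RInt2|].
  intros x _. apply RInt_ge_0; [lra|now apply cont2_ex_RInt|]. intros y _. apply Hp.
Qed.

Lemma cont2_sum (G : nat -> R -> R -> R) (n : nat) : (forall j, cont2 (G j)) ->
  cont2 (fun x y => sum_f_R0 (fun j => G j x y) n).
Proof. intros H. induction n; simpl; [apply H|]. now apply cont2_plus. Qed.

Lemma box_integral_sum (G : nat -> R -> R -> R) (n : nat) : (forall j, cont2 (G j)) ->
  box_integral a b (fun x y => sum_f_R0 (fun j => G j x y) n)
  = sum_f_R0 (fun j => box_integral a b (G j)) n.
Proof.
  intros H. induction n; simpl; [reflexivity|].
  rewrite box_integral_plus; [|now apply cont2_sum|apply H]. now rewrite IHn.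
Qed.

Lemma cont2_sum_int (M : nat) (G : nat -> R -> R -> R) : (forall j, cont2 (G j)) ->
  cont2 (fun x y => sum_int M (fun j => G j x y)).
Proof.
  intros H. unfold sum_int. apply cont2_mult; [|apply cont2_const].
  now apply (cont2_sum (fun j => G (S j))).
Qed.

Lemma box_integral_ext (f g : R -> R -> R) : (forall x y, f x y = g x y) ->
  box_integral a b f = box_integral a b g.
Proof. intros H. apply RInt_ext. intros x _. apply RInt_ext. intros y _. apply H. Qed.

Lemma box_integral_sum_int (M : nat) (G : nat -> R -> R -> R) : (forall j, cont2 (G j)) ->
  box_integral a b (fun x y => sum_int M (fun j => G j x y))
  = sum_int M (fun j => box_integral a b (G j)).
Proof.
  intros H. unfold sum_int. set (c := if (2 <=? M)%nat then 1 else 0).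
  rewrite (box_integral_ext _ (fun x y => c * sum_f_R0 (fun j => G (S j) x y) (M - 2)))
    by (intros; ring).
  rewrite box_integral_scal by (now apply (cont2_sum (fun j => G (S j)))).
  rewrite (box_integral_sum (fun j => G (S j))) by (intros; apply H). ring.
Qed.
End Box.

Lemma rpow_nonneg (x p : R) : 0 <= rpow x p.
Proof. unfold rpow. destruct (Rle_dec x 0); [lra|left; apply exp_pos]. Qed.

(** Base 0 is the case that matters: the Fourier symbol vanishes at the origin, and [tight_gap]
    evaluates [Wb] at distance 0. *)
Lemma rpow_continuous (p x : R) : 0 < p -> continuity_pt (fun t => rpow t p) x.
Proof.
  intros Hp. destruct (Rtotal_order x 0) as [Hx|[->|Hx]].
  - apply continuity_pt_ext_loc with (fun _ => 0).
    + exists (mkposreal (- x) ltac:(lra)). intros y Hy.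
      unfold ball in Hy; simpl in Hy; unfold AbsRing_ball, abs, minus, plus, opp in Hy; simpl in Hy.
      apply Rabs_def2 in Hy. unfold rpow. destruct (Rle_dec y 0); lra.
    + apply continuity_pt_const. now intros y z.
  - intros eps Heps. exists (Rpower eps (/ p)). split; [apply exp_pos|].
    intros y [_ Hy]. simpl in *. unfold R_dist in *. rewrite rpow_zero.
    unfold rpow. destruct (Rle_dec y 0); [rewrite Rminus_0_r, Rabs_R0; lra|].
    rewrite Rminus_0_r in *. rewrite Rabs_right in Hy by lra.
    rewrite Rabs_right by (left; apply exp_pos).
    apply Rlt_le_trans with (Rpower (Rpower eps (/ p)) p).
    + apply Rlt_Rpower_l; lra.
    + rewrite Rpower_mult, Rinv_l, Rpower_1 by lra. lra.
  - apply continuity_pt_ext_loc with (fun t => Rpower t p).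
    + exists (mkposreal x Hx). intros y Hy.
      unfold ball in Hy; simpl in Hy; unfold AbsRing_ball, abs, minus, plus, opp in Hy; simpl in Hy.
      apply Rabs_def2 in Hy. unfold rpow. destruct (Rle_dec y 0); lra.
    + apply continuity_pt_filterlim, (ex_derive_continuous (fun t => Rpower t p)).
      eexists. now apply is_derive_Rpower.
Qed.

(** The Fourier symbol of the five-point Laplacian with unit mesh, raised to the power [be / 2]. *)
Definition symbol (be e1 e2 : R) : R :=
  rpow (4 * sin (e1 / 2) ^ 2 + 4 * sin (e2 / 2) ^ 2) (be / 2).

Lemma cont2_fst (f : R -> R) : (forall x, continuity_pt f x) -> cont2 (fun x _ => f x).
Proof.
  intros Hf x y. apply (continuity_1d_2d_pt_comp f (fun u _ => u)); [apply Hf|].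
  apply continuity_2d_pt_id1.
Qed.

Lemma cont2_snd (f : R -> R) : (forall x, continuity_pt f x) -> cont2 (fun _ y => f y).
Proof.
  intros Hf x y. apply (continuity_1d_2d_pt_comp f (fun _ v => v)); [apply Hf|].
  apply continuity_2d_pt_id2.
Qed.

Lemma symbol_cont2 (be : R) : 0 < be -> cont2 (symbol be).
Proof.
  intros Hb x y. unfold symbol.
  apply (continuity_1d_2d_pt_comp (fun t => rpow t (be / 2))
           (fun x y => 4 * sin (x / 2) ^ 2 + 4 * sin (y / 2) ^ 2)).
  - apply rpow_continuous. lra.
  - assert (C : forall x, continuity_pt (fun x => 4 * sin (x / 2) ^ 2) x).
    { intros t. apply continuity_pt_filterlim.
      apply (ex_derive_continuous (fun x => 4 * sin (x / 2) ^ 2)). auto_derive. exact I. }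
    apply (cont2_plus (fun x _ => 4 * sin (x / 2) ^ 2) (fun _ y => 4 * sin (y / 2) ^ 2)).
    + now apply cont2_fst.
    + now apply cont2_snd.
Qed.

Lemma trig_cont2 (f : R -> R) (p q : R) : (forall x, continuity_pt f x) ->
  cont2 (fun x y => f (x * p + y * q)).
Proof.
  intros Hf x y. apply (continuity_1d_2d_pt_comp f (fun x y => x * p + y * q)); [apply Hf|].
  apply continuity_2d_pt_plus; apply continuity_2d_pt_mult;
    (apply continuity_2d_pt_id1 || apply continuity_2d_pt_id2 || apply continuity_2d_pt_const).
Qed.

Definition sum_int2 (M : nat) (F : nat -> nat -> R) : R :=
  sum_int M (fun j => sum_int M (fun k => F j k)).

Lemma sum_int2_ext (M : nat) (F G : nat -> nat -> R) :
  (forall j k, (1 <= j <= M - 1)%nat -> (1 <= k <= M - 1)%nat -> F j k = G j k) ->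
  sum_int2 M F = sum_int2 M G.
Proof. intros H. apply sum_int_ext; intros j Hj. apply sum_int_ext; intros k Hk. now apply H. Qed.

Lemma sum_int2_plus (M : nat) (F G : nat -> nat -> R) :
  sum_int2 M (fun j k => F j k + G j k) = sum_int2 M F + sum_int2 M G.
Proof.
  unfold sum_int2. rewrite <- sum_int_plus. apply sum_int_ext; intros; apply sum_int_plus.
Qed.

Lemma sum_int2_scal (M : nat) (c : R) (F : nat -> nat -> R) :
  sum_int2 M (fun j k => c * F j k) = c * sum_int2 M F.
Proof.
  unfold sum_int2. rewrite <- sum_int_scal. apply sum_int_ext; intros; apply sum_int_scal.
Qed.

Lemma sum_int2_nonneg (M : nat) (F : nat -> nat -> R) :
  (forall j k, 0 <= F j k) -> 0 <= sum_int2 M F.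
Proof. intros H. apply sum_int_nonneg; intros. apply sum_int_nonneg; intros. apply H. Qed.

(** Both sides are the squared modulus of the sum of [w j k * exp (i * th j k)], written with real
    functions. *)
Lemma cos_form (M : nat) (w : nat -> nat -> R) (th : nat -> nat -> R) :
  sum_int2 M (fun j k => sum_int2 M (fun j' k' => w j k * w j' k' * cos (th j' k' - th j k)))
  = (sum_int2 M (fun j k => w j k * cos (th j k))) ^ 2
    + (sum_int2 M (fun j k => w j k * sin (th j k))) ^ 2.
Proof.
  set (A := sum_int2 M (fun j k => w j k * cos (th j k))).
  set (B := sum_int2 M (fun j k => w j k * sin (th j k))).
  rewrite (sum_int2_ext M _ (fun j k => A * (w j k * cos (th j k)) + B * (w j k * sin (th j k)))).
  - rewrite sum_int2_plus, !sum_int2_scal. fold A B. ring.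
  - intros j k _ _.
    rewrite (sum_int2_ext M _ (fun j' k' => (w j k * cos (th j k)) * (w j' k' * cos (th j' k'))
       + (w j k * sin (th j k)) * (w j' k' * sin (th j' k')))).
    + rewrite sum_int2_plus, !sum_int2_scal. fold A B. ring.
    + intros j' k' _ _. rewrite cos_minus. ring.
Qed.

Lemma continuity_pt_cos (x : R) : continuity_pt cos x.
Proof. apply continuity_cos. Qed.

Lemma cont2_sum_int2 (M : nat) (G : nat -> nat -> R -> R -> R) : (forall j k, cont2 (G j k)) ->
  cont2 (fun x y => sum_int2 M (fun j k => G j k x y)).
Proof.
  intros H. unfold sum_int2.
  apply (cont2_sum_int M (fun j x y => sum_int M (fun k => G j k x y))).
  intros j. apply (cont2_sum_int M (G j)). apply H.
Qed.

Lemma box_integral_sum_int2 (a b : R) (M : nat) (G : nat -> nat -> R -> R -> R) :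
  a < b -> (forall j k, cont2 (G j k)) ->
  box_integral a b (fun x y => sum_int2 M (fun j k => G j k x y))
  = sum_int2 M (fun j k => box_integral a b (G j k)).
Proof.
  intros Hab H. unfold sum_int2.
  rewrite (box_integral_sum_int a b Hab M (fun j x y => sum_int M (fun k => G j k x y))).
  - apply sum_int_ext; intros j _. apply (box_integral_sum_int a b Hab M (G j)). apply H.
  - intros j. apply (cont2_sum_int M (G j)). apply H.
Qed.

(** The coefficients form a Toeplitz array generated by a nonnegative symbol. Exchanging the finite
    sums with the integral turns the quadratic form into the integral of the symbol times the
    squared modulus of the trigonometric polynomial of [w]. *)
Lemma frac_lap_nonneg (be h : R) (M : nat) (w : nat -> nat -> R) : 0 < be ->
  0 <= sum_int2 M (fun j k => frac_lap be h M w j k * w j k).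
Proof.
  intros Hb. assert (HP := PI_RGT_0).
  set (g := fun (j k j' k' : nat) (x y : R) => w j k * w j' k' * (symbol be x y *
     cos (x * IZR (Z.of_nat j' - Z.of_nat j) + y * IZR (Z.of_nat k' - Z.of_nat k)))).
  assert (Hg0 : forall j k j' k', cont2 (fun x y => symbol be x y *
     cos (x * IZR (Z.of_nat j' - Z.of_nat j) + y * IZR (Z.of_nat k' - Z.of_nat k)))).
  { intros. apply cont2_mult; [now apply symbol_cont2|]. apply trig_cont2, continuity_pt_cos. }
  assert (Hg : forall j k j' k', cont2 (g j k j' k')).
  { intros. apply cont2_mult; [apply cont2_const|apply Hg0]. }
  assert (Hg2 : forall j k, cont2 (fun x y => sum_int2 M (fun j' k' => g j k j' k' x y))).
  { intros. now apply (cont2_sum_int2 M (g j k)). }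
  rewrite (sum_int2_ext M _ (fun j k => (/ Rpower h be * / (4 * PI ^ 2)) *
     box_integral (- PI) PI (fun x y => sum_int2 M (fun j' k' => g j k j' k' x y)))).
  - rewrite sum_int2_scal.
    rewrite <- (box_integral_sum_int2 (- PI) PI M
      (fun j k x y => sum_int2 M (fun j' k' => g j k j' k' x y))); [|lra|exact Hg2].
    apply Rmult_le_pos.
    + left. apply Rmult_lt_0_compat; apply Rinv_0_lt_compat; [apply exp_pos|nra].
    + apply box_integral_nonneg; [lra| |].
      * apply (cont2_sum_int2 M (fun j k x y => sum_int2 M (fun j' k' => g j k j' k' x y))), Hg2.
      * intros x y. unfold g.
        rewrite (sum_int2_ext M _ (fun j k => symbol be x y *
          sum_int2 M (fun j' k' => w j k * w j' k' *
            cos ((x * INR j' + y * INR k') - (x * INR j + y * INR k))))).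
        -- rewrite sum_int2_scal, (cos_form M w (fun j k => x * INR j + y * INR k)).
           apply Rmult_le_pos; [apply rpow_nonneg|].
           apply Rplus_le_le_0_compat; apply pow2_ge_0.
        -- intros j k _ _. rewrite <- sum_int2_scal. apply sum_int2_ext. intros j' k' _ _.
           rewrite !minus_IZR, <- !INR_IZR_INZ.
           replace (x * INR j' + y * INR k' - (x * INR j + y * INR k))
             with (x * (INR j' - INR j) + y * (INR k' - INR k)) by ring.
           ring.
  - intros j k _ _. rewrite (box_integral_sum_int2 (- PI) PI M (g j k)); [|lra|apply Hg].
    unfold frac_lap. fold (sum_int2 M (fun j' k' => frac_coef be (Z.of_nat j' - Z.of_nat j)
       (Z.of_nat k' - Z.of_nat k) * w j' k')).
    rewrite Rmult_assoc, Rmult_assoc. f_equal.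
    rewrite Rmult_comm, <- !sum_int2_scal. apply sum_int2_ext. intros j' k' _ _.
    unfold g. rewrite box_integral_scal; [|lra|apply Hg0].
    unfold frac_coef, box_integral, symbol. ring.
Qed.

(** * Energy estimate *)

Section Inner.
Variables (h : R) (M : nat).

Lemma inner_h_ext (w w' v : nat -> nat -> R) :
  (forall j k, (1 <= j <= M - 1)%nat -> (1 <= k <= M - 1)%nat -> w j k = w' j k) ->
  inner_h h M w v = inner_h h M w' v.
Proof.
  intros H. unfold inner_h. f_equal. apply sum_int2_ext. intros j k Hj Hk. now rewrite H.
Qed.

Lemma inner_h_sym (w v : nat -> nat -> R) : inner_h h M w v = inner_h h M v w.
Proof. unfold inner_h. f_equal. apply sum_int2_ext. intros; ring. Qed.

Lemma inner_h_plus (w w' v : nat -> nat -> R) :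
  inner_h h M (fun j k => w j k + w' j k) v = inner_h h M w v + inner_h h M w' v.
Proof.
  unfold inner_h. rewrite <- Rmult_plus_distr_l. f_equal.
  etransitivity; [|apply sum_int2_plus]. apply sum_int2_ext. intros; ring.
Qed.

Lemma inner_h_scal (c : R) (w v : nat -> nat -> R) :
  inner_h h M (fun j k => c * w j k) v = c * inner_h h M w v.
Proof.
  unfold inner_h. rewrite <- Rmult_assoc, (Rmult_comm c), Rmult_assoc. f_equal.
  etransitivity; [|apply sum_int2_scal]. apply sum_int2_ext. intros; ring.
Qed.

Lemma inner_h_sum (G : nat -> nat -> nat -> R) (v : nat -> nat -> R) (n : nat) :
  inner_h h M (fun j k => sum_f_R0 (fun i => G i j k) n) v
  = sum_f_R0 (fun i => inner_h h M (G i) v) n.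
Proof. induction n; simpl; [reflexivity|]. now rewrite inner_h_plus, IHn. Qed.

Lemma inner_h_nonneg (w : nat -> nat -> R) : 0 <= inner_h h M w w.
Proof.
  apply Rmult_le_pos; [apply pow2_ge_0|]. apply (sum_int2_nonneg M (fun j k => w j k * w j k)).
  intros. nra.
Qed.

Lemma norm_h_nonneg (w : nat -> nat -> R) : 0 <= norm_h h M w.
Proof. apply sqrt_pos. Qed.

Lemma norm_h_sqr (w : nat -> nat -> R) : norm_h h M w * norm_h h M w = inner_h h M w w.
Proof. apply sqrt_sqrt, inner_h_nonneg. Qed.

Lemma Cauchy_Schwarz_h (w v : nat -> nat -> R) :
  inner_h h M w v <= norm_h h M w * norm_h h M v.
Proof.
  set (A := inner_h h M w w). set (B := inner_h h M w v). set (D := inner_h h M v v).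
  assert (Q : forall s, 0 <= A + 2 * s * B + s * s * D).
  { intros s. assert (P := inner_h_nonneg (fun j k => w j k + s * v j k)).
    rewrite inner_h_plus, inner_h_scal in P.
    rewrite (inner_h_sym w), (inner_h_sym v), !inner_h_plus, !inner_h_scal in P.
    rewrite (inner_h_sym v w) in P. fold A B D in P. lra. }
  assert (HA := inner_h_nonneg w). assert (HD := inner_h_nonneg v). fold A in HA. fold D in HD.
  assert (HBB : B * B <= A * D).
  { destruct HD as [HD|HD].
    - specialize (Q (- B / D)).
      replace (A + 2 * (- B / D) * B + - B / D * (- B / D) * D) with ((A * D - B * B) / D) in Q
        by (field; lra).
      assert (0 <= (A * D - B * B) / D * D) by (apply Rmult_le_pos; lra).
      replace ((A * D - B * B) / D * D) with (A * D - B * B) in H by (field; lra). lra.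
    - rewrite <- HD in Q |- *.
      destruct (Req_dec B 0) as [->|HB]; [lra|].
      (* With [D = 0] the quadratic is affine in [s]; if [B] were nonzero, this [s] would give it
         the value -1. *)
      specialize (Q (- (A + 1) / (2 * B))).
      replace (A + 2 * (- (A + 1) / (2 * B)) * B + - (A + 1) / (2 * B) * (- (A + 1) / (2 * B)) * 0)
        with (-1) in Q by (field; lra). lra. }
  unfold norm_h. fold A D. rewrite <- sqrt_mult by lra.
  destruct (Rle_dec B 0); [apply Rle_trans with 0; [lra|apply sqrt_pos]|].
  rewrite <- (sqrt_square B) by lra. now apply sqrt_le_1_alt.
Qed.

(** Testing with [W] lets the Laplacian term be dropped, and one factor of the norm cancels. When
    that norm is 0 the conclusion reduces to [0 <= K]. *)
Lemma energy_bound (be c K : R) (W G : nat -> nat -> R) : 0 < be -> 0 <= K ->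
  (forall j k, (1 <= j <= M - 1)%nat -> (1 <= k <= M - 1)%nat ->
     c * W j k + frac_lap be h M W j k = G j k) ->
  inner_h h M G W <= K * norm_h h M W -> c * norm_h h M W <= K.
Proof.
  intros Hb HK HE HG.
  assert (P : 0 <= inner_h h M (frac_lap be h M W) W).
  { apply Rmult_le_pos; [apply pow2_ge_0|]. now apply frac_lap_nonneg. }
  rewrite <- (inner_h_ext _ G W HE), inner_h_plus, inner_h_scal, <- norm_h_sqr in HG.
  destruct (norm_h_nonneg W) as [HW|<-]; [|lra].
  apply Rmult_le_reg_r with (norm_h h M W); [exact HW|]. lra.
Qed.
End Inner.

Lemma sum_f_R0_telescope (u : nat -> R) (n : nat) :
  sum_f_R0 (fun i => u (S (S i)) - u (S i)) n = u (S (S n)) - u 1%nat.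
Proof. induction n; simpl; [ring|rewrite IHn; ring]. Qed.

Lemma fold_right_Rmax_ge (l : list R) (v : R) : In v l -> v <= fold_right Rmax 0 l.
Proof.
  induction l as [|x l IH]; simpl; [easy|]. intros [->|H]; [apply Rmax_l|].
  eapply Rle_trans; [now apply IH|apply Rmax_r].
Qed.

Lemma fold_right_Rmax_le (l : list R) (b : R) : 0 <= b -> (forall v, In v l -> v <= b) ->
  fold_right Rmax 0 l <= b.
Proof.
  intros Hb. induction l as [|x l IH]; simpl; intros H; [exact Hb|].
  apply Rmax_lub; [apply H; now left|]. apply IH. intros v Hv; apply H; now right.
Qed.

Lemma fold_right_Rmax_nonneg (l : list R) : 0 <= fold_right Rmax 0 l.
Proof. induction l; simpl; [lra|]. eapply Rle_trans; [exact IHl|apply Rmax_r]. Qed.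

Section Stability.
Variables (al be a T L : R) (N M : nat) (f : R -> R -> R -> R) (u0 : R -> R -> R).
Variable U : nat -> nat -> nat -> R.
Hypothesis Hbe : 0 < be.
Hypothesis HU : is_L12_solution al be a T L N M f u0 U.
Let h := 2 * L / INR M.
Let F := fun (n j k : nat) => f (- L + INR j * h) (- L + INR k * h) (tgrid a T N n).
Let c := c_coef al a T N.
Let nrm := norm_h h M.

Hypothesis c_pos : forall n, (1 <= n <= N)%nat -> 0 < c 1 n.
Hypothesis c_mono : forall i n, (1 <= i)%nat -> (i < n <= N)%nat -> c i n <= c (S i) n.

Lemma first_step_bound : (1 <= N)%nat -> c 1 1 * nrm (U 1%nat) <= c 1 1 * nrm (U 0%nat) + nrm (F 1%nat).
Proof.
  intros HN. destruct HU as [_ [_ [E _]]]. fold h in E. fold c in E.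
  assert (Hc := c_pos 1 ltac:(lia)).
  assert (P0 := norm_h_nonneg h M (U 0%nat)). assert (PF := norm_h_nonneg h M (F 1%nat)).
  apply (energy_bound h M be _ _ (U 1%nat) (fun j k => c 1 1 * U 0%nat j k + F 1%nat j k)).
  - exact Hbe.
  - unfold nrm. nra.
  - intros j k Hj Hk. specialize (E j k Hj Hk). unfold F. lra.
  - rewrite inner_h_plus, inner_h_scal.
    assert (C0 := Cauchy_Schwarz_h h M (U 0%nat) (U 1%nat)).
    assert (C1 := Cauchy_Schwarz_h h M (F 1%nat) (U 1%nat)). unfold nrm. nra.
Qed.

(** Moved to the right-hand side, the history terms carry the weights [c_(i+1,n) - c_(i,n)].
    Monotonicity makes these nonnegative, so Cauchy-Schwarz applies term by term. The summation
    index [i] stands for time level [i + 1]. *)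
Lemma later_step_bound (n : nat) : (2 <= n <= N)%nat ->
  c n n * nrm (U n) <= sum_f_R0 (fun i => (c (S (S i)) n - c (S i) n) * nrm (U (S i))) (n - 2)
    + c 1 n * nrm (U 0%nat) + nrm (F n).
Proof.
  intros Hn. destruct HU as [_ [_ [_ E]]]. fold h in E. fold c in E.
  assert (Hc := c_pos n ltac:(lia)).
  assert (Hm : forall i, (i <= n - 2)%nat -> 0 <= c (S (S i)) n - c (S i) n).
  { intros i Hi. assert (H := c_mono (S i) n ltac:(lia) ltac:(lia)). lra. }
  assert (P0 := norm_h_nonneg h M (U 0%nat)). assert (PF := norm_h_nonneg h M (F n)).
  assert (PU := norm_h_nonneg h M (U n)).
  apply (energy_bound h M be _ _ (U n)
    (fun j k => (sum_f_R0 (fun i => (c (S (S i)) n - c (S i) n) * U (S i) j k) (n - 2)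
        + c 1 n * U 0%nat j k) + F n j k)).
  - exact Hbe.
  - assert (0 <= sum_f_R0 (fun i => (c (S (S i)) n - c (S i) n) * nrm (U (S i))) (n - 2)).
    { rewrite <- (sum_eq_R0 (fun _ => 0) (n - 2)) by auto.
      apply sum_Rle. intros i Hi. apply Rmult_le_pos; [now apply Hm|apply norm_h_nonneg]. }
    unfold nrm in *. nra.
  - intros j k Hj Hk. specialize (E n j k Hn Hj Hk). unfold F.
    rewrite <- E. cbv zeta.
    replace (sum_f_R0 (fun i => (c (S (S i)) n - c (S i) n) * U (S i) j k) (n - 2))
      with (- sum_f_R0 (fun i0 => (c (S i0) n - c (S (S i0)) n) * U (S i0) j k) (n - 2)).
    + ring.
    + rewrite <- (Rmult_1_l (sum_f_R0 _ _)), Ropp_mult_distr_l, scal_sum.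
      apply sum_eq. intros; ring.
  - rewrite !inner_h_plus, inner_h_scal.
    rewrite (inner_h_sum h M (fun i j k => (c (S (S i)) n - c (S i) n) * U (S i) j k)).
    assert (C0 := Cauchy_Schwarz_h h M (U 0%nat) (U n)).
    assert (C1 := Cauchy_Schwarz_h h M (F n) (U n)).
    assert (CS : sum_f_R0 
         (fun i => inner_h h M (fun j k => (c (S (S i)) n - c (S i) n) * U (S i) j k) (U n)) (n - 2)
       <= sum_f_R0 (fun i => (c (S (S i)) n - c (S i) n) * nrm (U (S i))) (n - 2) * nrm (U n)).
    { rewrite Rmult_comm, scal_sum. apply sum_Rle. intros i Hi.
      rewrite inner_h_scal, Rmult_assoc. apply Rmult_le_compat_l; [now apply Hm|].
      apply Cauchy_Schwarz_h. }
    unfold nrm in *. nra.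
Qed.

(** The assumption on [g] gives [nrm (F n) <= c 1 n * m n], so the source merges with the initial
    term into [c 1 n * E]. The history weights telescope to [c n n - c 1 n], and by strong induction
    each earlier norm is at most [E]. The total weight on the right is thus exactly [c n n], which
    cancels without any growth factor. *)
Lemma stability_bound (g : nat -> R) : 
  (forall n, (1 <= n <= N)%nat -> 1 <= c 1 n * g n) ->
  forall n, (1 <= n <= N)%nat ->
  nrm (U n) <= nrm (U 0%nat) + fold_right Rmax 0 (map (fun k => g k * nrm (F k)) (seq 1 n)).
Proof.
  intros Hg. set (m := fun n => fold_right Rmax 0 (map (fun k => g k * nrm (F k)) (seq 1 n))).
  assert (Hin : forall k n, (1 <= k <= n)%nat -> g k * nrm (F k) <= m n).
  { intros k n Hk. apply fold_right_Rmax_ge, in_map_iff. exists k. split; [easy|].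
    apply in_seq; lia. }
  assert (Hm0 : forall n, 0 <= m n) by (intros; apply fold_right_Rmax_nonneg).
  assert (Hmono : forall k n, (k <= n)%nat -> m k <= m n).
  { intros k n Hk. apply fold_right_Rmax_le; [apply Hm0|].
    intros v Hv. apply in_map_iff in Hv. destruct Hv as [i [<- Hi]]. apply in_seq in Hi.
    apply Hin; lia. }
  assert (HF : forall n, (1 <= n <= N)%nat -> nrm (F n) <= c 1 n * m n).
  { intros n Hn. apply Rle_trans with (c 1 n * (g n * nrm (F n))).
    - specialize (Hg n Hn). assert (P := norm_h_nonneg h M (F n)). unfold nrm. nra.
    - apply Rmult_le_compat_l; [left; now apply c_pos|]. apply Hin; lia. }
  intros n. induction n as [n IH] using lt_wf_ind. intros Hn. fold (m n).
  specialize (HF n Hn). assert (Hc := c_pos n Hn).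
  destruct (Nat.eq_dec n 1) as [->|Hn1].
  - assert (St := first_step_bound ltac:(lia)).
    apply Rmult_le_reg_l with (c 1 1); [exact Hc|]. lra.
  - assert (St := later_step_bound n ltac:(lia)).
    set (E := nrm (U 0%nat) + m n) in *.
    assert (CS : sum_f_R0 (fun i => (c (S (S i)) n - c (S i) n) * nrm (U (S i))) (n - 2)
       <= sum_f_R0 (fun i => c (S (S i)) n - c (S i) n) (n - 2) * E).
    { rewrite Rmult_comm, scal_sum. apply sum_Rle. intros i Hi. apply Rmult_le_compat_l.
      - assert (H := c_mono (S i) n ltac:(lia) ltac:(lia)). lra.
      - specialize (IH (S i) ltac:(lia) ltac:(lia)). fold (m (S i)) in IH.
        assert (H := Hmono (S i) n ltac:(lia)). unfold E. lra. }
    rewrite (sum_f_R0_telescope (fun i => c i n)) in CS.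
    replace (S (S (n - 2))) with n in CS by lia.
    assert (Hcn : forall i, (1 <= i <= n)%nat -> c 1 n <= c i n).
    { induction i as [|i IHi]; intros Hi; [lia|].
      destruct (Nat.eq_dec i 0) as [->|Hi0]; [lra|].
      eapply Rle_trans; [apply IHi; lia|]. apply c_mono; lia. }
    assert (Hcnn := Hcn n ltac:(lia)).
    apply Rmult_le_reg_l with (c n n); [lra|]. unfold E in *. lra.
Qed.
End Stability.

(** * Positivity on the uniform grid *)

(* [INR (fact n)] would be expanded in unary by [simpl]. *)
Fixpoint Rfact (n : nat) : R :=
  match n with O => 1 | S m => INR (S m) * Rfact m end.

Lemma Rfact_neq_0 (n : nat) : Rfact n <> 0.
Proof.
  induction n as [|n IH]; [simpl; lra|].
  apply Rmult_integral_contrapositive_currified; [apply not_0_INR; lia|exact IH].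
Qed.

Definition exp_neg_taylor (n : nat) (x : R) : R :=
  sum_f_R0 (fun k => (- x) ^ k / Rfact k) n.

Lemma exp_neg_taylor_derive (n : nat) (x : R) :
  is_derive (exp_neg_taylor (S n)) x (- exp_neg_taylor n x).
Proof.
  unfold exp_neg_taylor. induction n as [|n IH].
  - simpl. auto_derive; [exact I|field].
  - apply (is_derive_ext (fun x => plus (sum_f_R0 (fun k => (- x) ^ k / Rfact k) (S n))
        ((- x) ^ (S (S n)) / Rfact (S (S n))))); [reflexivity|].
    replace (- sum_f_R0 (fun k => (- x) ^ k / Rfact k) (S n)) with
      (plus (- sum_f_R0 (fun k => (- x) ^ k / Rfact k) n) (- ((- x) ^ (S n) / Rfact (S n))))
      by (unfold plus; simpl; ring).
    apply (is_derive_plus (V := R_NormedModule)); [exact IH|].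
    change (Rfact (S (S n))) with (INR (S (S n)) * Rfact (S n)).
    assert (H1 := Rfact_neq_0 (S n)). assert (H2 : INR (S (S n)) <> 0) by (apply not_0_INR; lia).
    replace (- ((- x) ^ S n / Rfact (S n))) with
      (- INR (S (S n)) * (- x) ^ pred (S (S n)) / (INR (S (S n)) * Rfact (S n)))
      by (change (pred (S (S n))) with (S n); field; auto).
    generalize (INR (S (S n)) * Rfact (S n)) as q. generalize (S (S n)) as m. intros m q.
    auto_derive; [exact I|]. unfold Rdiv. ring.
Qed.

(** The signed remainder vanishes at 0 and its derivative is the signed remainder of the previous
    degree. Hence truncations of odd degree lie below [exp (- x)] and those of even degree above,
    for every [x >= 0]. *)
Lemma exp_neg_taylor_sign (n : nat) (x : R) : 0 <= x ->
  0 <= (-1) ^ (S n) * (exp (- x) - exp_neg_taylor n x).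
Proof.
  revert x. induction n as [|n IH].
  - intros x Hx. unfold exp_neg_taylor. simpl.
    assert (exp (- x) <= exp 0) by (destruct (Req_dec x 0) as [->|]; [rewrite Ropp_0; lra|
      left; apply exp_increasing; lra]).
    rewrite exp_0 in H. lra.
  - apply (nonneg_of_derive _ (fun x => (-1) ^ (S n) * (exp (- x) - exp_neg_taylor n x))).
    + intros x Hx.
      apply (is_derive_ext (fun x => scal ((-1) ^ S (S n)) (minus (exp (- x)) (exp_neg_taylor (S n) x)))).
      * intros t. reflexivity.
      * replace ((-1) ^ (S n) * (exp (- x) - exp_neg_taylor n x)) with
         (scal ((-1) ^ S (S n)) (minus (- exp (- x)) (- exp_neg_taylor n x)))
         by (unfold scal, minus, plus, opp; simpl; unfold mult; simpl; ring).
        apply (is_derive_scal (fun x => minus (exp (- x)) (exp_neg_taylor (S n) x)) x).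
        apply (is_derive_minus (V := R_NormedModule)).
        -- auto_derive; [exact I|ring].
        -- apply exp_neg_taylor_derive.
    + intros t Ht. now apply IH.
    + replace (exp_neg_taylor (S n) 0) with 1; [rewrite Ropp_0, exp_0; right; ring|].
      unfold exp_neg_taylor. clear. induction n as [|n IH].
      * simpl. field.
      * rewrite tech5, <- IH. simpl. unfold Rdiv. ring.
Qed.

(** A violated bound would place [exp] of the negated decimal on the wrong side of [1/2]; the
    truncation of degree 11 (from below) or 10 (from above) excludes this. *)
Lemma ln_2_bounds : 0.6931471 <= ln 2 <= 0.6931472.
Proof.
  assert (E : exp (- ln 2) = / 2) by (rewrite exp_Ropp, exp_ln by lra; reflexivity).
  split; apply Rnot_lt_le; intros H.
  - assert (B := exp_neg_taylor_sign 11 0.6931471 ltac:(lra)).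
    assert (I : exp (- (0.6931471)) < exp (- ln 2)) by (apply exp_increasing; lra).
    unfold exp_neg_taylor in B. simpl in B. lra.
  - assert (B := exp_neg_taylor_sign 10 0.6931472 ltac:(lra)).
    assert (I : exp (- ln 2) < exp (- (0.6931472))) by (apply exp_increasing; lra).
    unfold exp_neg_taylor in B. simpl in B. lra.
Qed.

Lemma ln_3_2_bounds : 0.4054651 <= ln (3 / 2) <= 0.4054652.
Proof.
  assert (E : exp (- ln (3 / 2)) = / (3 / 2)) by (rewrite exp_Ropp, exp_ln by lra; reflexivity).
  split; apply Rnot_lt_le; intros H.
  - assert (B := exp_neg_taylor_sign 11 0.4054651 ltac:(lra)).
    assert (I : exp (- (0.4054651)) < exp (- ln (3 / 2))) by (apply exp_increasing; lra).
    unfold exp_neg_taylor in B. simpl in B. lra.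
  - assert (B := exp_neg_taylor_sign 10 0.4054652 ltac:(lra)).
    assert (I : exp (- ln (3 / 2)) < exp (- (0.4054652))) by (apply exp_increasing; lra).
    unfold exp_neg_taylor in B. simpl in B. lra.
Qed.

Lemma ln_3_lower : 1.0986122 <= ln 3.
Proof.
  replace 3 with (2 * (3 / 2)) by field. rewrite ln_mult by lra.
  assert (H1 := ln_2_bounds). assert (H2 := ln_3_2_bounds). lra.
Qed.

Lemma Rpower_neg_ge_taylor (b l x : R) (n : nat) : 0 <= x -> 0 <= l -> ln b <= l -> Nat.Odd n ->
  exp_neg_taylor n (l * x) <= Rpower b (- x).
Proof.
  intros Hx Hl Hb Hn. assert (B := exp_neg_taylor_sign n (l * x) ltac:(nra)).
  replace ((-1) ^ S n) with 1 in B.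
  - apply Rle_trans with (exp (- (l * x))); [lra|]. unfold Rpower.
    destruct (Req_dec (- (l * x)) (- x * ln b)) as [->|]; [lra|left; apply exp_increasing; nra].
  - destruct Hn as [m ->]. replace (S (2 * m + 1)) with (2 * (m + 1))%nat by lia.
    symmetry. apply pow_1_even.
Qed.

Lemma Rpower_neg_le_taylor (b l x : R) (n : nat) : 0 <= x -> 0 <= l -> l <= ln b -> Nat.Even n ->
  Rpower b (- x) <= exp_neg_taylor n (l * x).
Proof.
  intros Hx Hl Hb Hn. assert (B := exp_neg_taylor_sign n (l * x) ltac:(nra)).
  replace ((-1) ^ S n) with (-1) in B.
  - apply Rle_trans with (exp (- (l * x))); [|lra]. unfold Rpower.
    destruct (Req_dec (- (l * x)) (- x * ln b)) as [->|]; [lra|left; apply exp_increasing; nra].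
  - destruct Hn as [m ->]. symmetry. apply pow_1_odd.
Qed.

(* The function vanishes at [0] and has its next zero at 0.37386..., so Taylor bounds accurate to
   about 1e-5 are needed near the right end. *)
Lemma uniform_grid_positivity (al : R) : 0 < al < 0.3738 ->
  0 < (36 - 6 * al) * Rpower 2 (- al) - (24 - 3 * al) * Rpower 3 (- al) - (12 - 3 * al).
Proof.
  intros Hal.
  assert (Hu := Rpower_neg_ge_taylor 2 0.6931472 al 5 ltac:(lra) ltac:(lra)
    (proj2 ln_2_bounds) ltac:(now exists 2%nat)).
  assert (Hv := Rpower_neg_le_taylor 3 1.0986122 al 6 ltac:(lra) ltac:(lra)
    ln_3_lower ltac:(now exists 3%nat)).
  assert (Hu' := Rmult_le_compat_l (36 - 6 * al) _ _ ltac:(lra) Hu).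
  assert (Hv' := Rmult_le_compat_l (24 - 3 * al) _ _ ltac:(lra) Hv).
  (* The constant terms of the two Taylor bounds and of [12 - 3 al] cancel, hence the factor [al].
     The other coefficients are rounded down and the positive term of degree 7 is dropped. *)
  assert (HP : 0 < al * (1.413393 - 4.972184 * al + 3.674790 * al ^ 2 - 1.440433 * al ^ 3
                 + 0.396456 * al ^ 4 - 0.090616 * al ^ 5)).
  { apply Rmult_lt_0_compat; [lra|].
    (* Synthetic division at 0.3738: the bracket equals this product, plus about
       [0.0906 (0.3738 - al) al^4], plus a positive remainder near [1e-4], which also covers the
       rounding. *)
    assert (0 <= (0.3738 - al) * (3.7808764 - 3.1870187 * al + 1.3048991 * al ^ 2
       - 0.3625838 * al ^ 3)).
    { apply Rmult_le_pos; [lra|]. simpl. nra. }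
    assert (0 <= (0.3738 - al) * al ^ 4) by (apply Rmult_le_pos; [lra|apply pow_le; lra]).
    assert (0 <= al ^ 2 <= 1) by (simpl; nra). assert (0 <= al ^ 3 <= 1) by (simpl; nra).
    assert (0 <= al ^ 4) by (apply pow_le; lra).
    lra. }
  assert (0 <= al ^ 2) by (apply pow_le; lra).
  assert (0 <= al ^ 3) by (apply pow_le; lra).
  assert (0 <= al ^ 4) by (apply pow_le; lra).
  assert (0 <= al ^ 5) by (apply pow_le; lra).
  assert (0 <= al ^ 6) by (apply pow_le; lra).
  assert (0 <= al ^ 7) by (apply pow_le; lra).
  unfold exp_neg_taylor in Hu', Hv'. simpl in Hu', Hv'. simpl in *. lra.
Qed.

(** * Comparison of neighbouring coefficients *)

Section Continuity.
Context {V : UniformSpace}.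
Variables (al : R) (z : V).
Hypothesis Hal : 0 < al < 1.

Lemma continuous_rpow (p : R) (f : V -> R) : 0 < p -> continuous f z ->
  continuous (fun z => rpow (f z) p) z.
Proof.
  intros Hp Hf. apply (continuous_comp f (fun t => rpow t p)); [exact Hf|].
  apply continuity_pt_filterlim, rpow_continuous, Hp.
Qed.

Lemma continuous_Rmult (f g : V -> R) : continuous f z -> continuous g z ->
  continuous (fun z => f z * g z) z.
Proof. apply (continuous_mult (K := R_AbsRing)). Qed.

Lemma continuous_Rplus (f g : V -> R) : continuous f z -> continuous g z ->
  continuous (fun z => f z + g z) z.
Proof. apply (continuous_plus (V := R_NormedModule)). Qed.

Lemma continuous_Rminus (f g : V -> R) : continuous f z -> continuous g z ->
  continuous (fun z => f z - g z) z.
Proof. apply (continuous_minus (V := R_NormedModule)). Qed.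

Lemma continuous_Rdiv (f g : V -> R) : continuous f z -> continuous g z -> g z <> 0 ->
  continuous (fun z => f z / g z) z.
Proof.
  intros Hf Hg Hn. apply continuous_Rmult; [exact Hf|].
  apply (continuous_comp g Rinv); [exact Hg|now apply continuous_Rinv].
Qed.

Lemma continuous_Wa (f g : V -> R) : continuous f z -> continuous g z ->
  continuous (fun z => Wa al (f z) (g z)) z.
Proof.
  intros Hf Hg. apply continuous_Rminus; apply continuous_rpow; try lra; auto.
  now apply continuous_Rplus.
Qed.

Lemma continuous_Wb (f g : V -> R) : continuous f z -> continuous g z ->
  continuous (fun z => Wb al (f z) (g z)) z.
Proof.
  intros Hf Hg. assert (Hs := continuous_Rplus f g Hf Hg).
  apply continuous_Rminus; apply continuous_Rmult; auto.
  - apply continuous_const.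
  - apply continuous_Rminus; apply continuous_rpow; auto; lra.
  - apply continuous_Rplus; apply continuous_rpow; auto; lra.
Qed.
End Continuity.

(* [d_k, d_(k-1), d_(k-2), d_(k-3)] are [p, q, r, s]: this is Gamma(2-al) (c_(k-1,k) - c_(k-2,k)). *)
Definition tight_gap (al p q r s : R) : R :=
  (Wa al p q + Wb al p q / (q + r) - Wb al 0 p / (p + q)) / q
  - (Wa al (p + q) r + Wb al (p + q) r / (r + s) - Wb al p q / (q + r)) / r.

Lemma rpow_one (p : R) : rpow 1 p = 1.
Proof. rewrite rpow_pos_base by lra. unfold Rpower. rewrite ln_1, Rmult_0_r. apply exp_0. Qed.

(** On unit steps every weight is a combination of 1, [2^(-al)] and [3^(-al)]; the gap is the
    expression of [uniform_grid_positivity] divided by [2 (2 - al)]. *)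
Lemma tight_gap_uniform_pos (al : R) : 0 < al < 0.3738 -> 0 < tight_gap al 1 1 1 1.
Proof.
  intros Hal. assert (H := uniform_grid_positivity al Hal).
  assert (E : forall b, 0 < b -> rpow b (1 - al) = b * Rpower b (- al)
                        /\ rpow b (2 - al) = b * b * Rpower b (- al)).
  { intros b Hb. rewrite !rpow_pos_base by lra. split.
    - replace (1 - al) with (- al + 1) by ring. rewrite Rpower_succ by lra. ring.
    - replace (2 - al) with (- al + 1 + 1) by ring. rewrite !Rpower_succ by lra. ring. }
  destruct (E 2 ltac:(lra)) as [E1 E2]. destruct (E 3 ltac:(lra)) as [E3 E4].
  unfold tight_gap, Wa, Wb. rewrite Rplus_0_l.
  replace (1 + 1) with 2 by ring. replace (2 + 1) with 3 by ring.
  rewrite !rpow_one, !rpow_zero, E1, E2, E3, E4.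
  set (u := Rpower 2 (- al)) in *. set (v := Rpower 3 (- al)) in *.
  match goal with |- 0 < ?e =>
    replace e with (((36 - 6 * al) * u - (24 - 3 * al) * v - (12 - 3 * al)) / (2 * (2 - al)))
      by (field; lra) end.
  apply Rdiv_lt_0_compat; lra.
Qed.

Lemma tight_gap_near_uniform (al : R) : 0 < al < 0.3738 ->
  exists del, 0 < del /\ forall q r s, Rabs (q - 1) < del -> Rabs (r - 1) < del ->
    Rabs (s - 1) < del -> 0 < tight_gap al 1 q r s.
Proof.
  intros Hal.
  set (F := fun z : R * (R * R) => tight_gap al 1 (fst z) (fst (snd z)) (snd (snd z))).
  assert (C : continuous F (1, (1, 1))).
  { assert (Cq : continuous (fun z : R * (R * R) => fst z) (1, (1, 1))) by apply continuous_fst.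
    assert (Cs' : continuous (fun z : R * (R * R) => snd z) (1, (1, 1))) by apply continuous_snd.
    assert (Cr : continuous (fun z : R * (R * R) => fst (snd z)) (1, (1, 1)))
      by (apply (continuous_comp _ fst); [exact Cs'|apply continuous_fst]).
    assert (Cs : continuous (fun z : R * (R * R) => snd (snd z)) (1, (1, 1)))
      by (apply (continuous_comp _ snd); [exact Cs'|apply continuous_snd]).
    assert (Cc : forall c : R, continuous (fun _ : R * (R * R) => c) (1, (1, 1)))
      by (intros; apply continuous_const).
    clear Cs'. unfold F, tight_gap.
    repeat match goal with
    | H : continuous ?f _ |- continuous ?f _ => exact H
    | |- continuous (fun _ => ?c) _ => exact (Cc c)
    | |- continuous (fun z => Wa al (@?f z) (@?g z)) _ => refine (continuous_Wa al _ _ f g _ _); [lra| |]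
    | |- continuous (fun z => Wb al (@?f z) (@?g z)) _ => refine (continuous_Wb al _ _ f g _ _); [lra| |]
    | |- continuous (fun z => @?f z / @?g z) _ => refine (continuous_Rdiv _ f g _ _ _); [| |simpl; lra]
    | |- continuous (fun z => @?f z - @?g z) _ => refine (continuous_Rminus _ f g _ _)
    | |- continuous (fun z => @?f z + @?g z) _ => refine (continuous_Rplus _ f g _ _)
    end. }
  assert (HF : 0 < F (1, (1, 1))) by now apply tight_gap_uniform_pos.
  destruct (C (fun y => 0 < y)) as [del Hdel].
  - exists (mkposreal _ HF). intros y Hy.
    unfold ball in Hy; simpl in Hy; unfold AbsRing_ball, abs, minus, plus, opp in Hy; simpl in Hy.
    apply Rabs_def2 in Hy. lra.
  - exists del. split; [apply cond_pos|]. intros q r s Hq Hr Hs.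
    apply (Hdel (q, (r, s))). now repeat split.
Qed.

Lemma rpow_scale (l x p : R) : 0 < l -> 0 <= x -> rpow (l * x) p = Rpower l p * rpow x p.
Proof.
  intros Hl [Hx|<-].
  - rewrite !rpow_pos_base by nra. symmetry. now apply Rpower_mult_distr.
  - rewrite Rmult_0_r, rpow_zero. ring.
Qed.

Section Scale.
Variables (al l : R).
Hypothesis Hal : 0 < al < 1.
Hypothesis Hl : 0 < l.

Lemma Wa_scale (x d : R) : 0 <= x -> 0 <= d ->
  Wa al (l * x) (l * d) = Rpower l (1 - al) * Wa al x d.
Proof.
  intros Hx Hd. unfold Wa. rewrite <- Rmult_plus_distr_l, !rpow_scale by lra. ring.
Qed.

Lemma Wb_scale (x d : R) : 0 <= x -> 0 <= d ->
  Wb al (l * x) (l * d) = Rpower l (1 - al) * l * Wb al x d.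
Proof.
  intros Hx Hd. unfold Wb. rewrite <- Rmult_plus_distr_l, !rpow_scale by lra.
  assert (E : Rpower l (2 - al) = Rpower l (1 - al) * l)
    by (rewrite <- Rpower_succ by lra; f_equal; ring).
  rewrite E. field. lra.
Qed.

(** Homogeneity of degree [-al] normalises the last step to 1, so a neighbourhood of the single
    point [(1, 1, 1)] serves grids of every size. *)
Lemma tight_gap_scale (q r s : R) : 0 < q -> 0 < r -> 0 < s ->
  tight_gap al (l * 1) (l * q) (l * r) (l * s) = Rpower l (1 - al) / l * tight_gap al 1 q r s.
Proof.
  intros Hq Hr Hs. unfold tight_gap. rewrite <- !Rmult_plus_distr_l.
  replace 0 with (l * 0) at 1 by ring.
  rewrite !Wa_scale, !Wb_scale by lra. field. repeat split; lra.
Qed.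
End Scale.

Lemma tight_gap_pos (al : R) : 0 < al < 0.3738 ->
  exists eps, 0 < eps <= 0.01 /\ forall p q r s, 0 < p ->
    p <= q <= (1 + eps) * p -> q <= r <= (1 + eps) * q -> r <= s <= (1 + eps) * r ->
    0 < tight_gap al p q r s.
Proof.
  intros Hal. destruct (tight_gap_near_uniform al Hal) as [del [Hdel H]].
  exists (Rmin 0.01 (del / 5)).
  assert (He1 := Rmin_l 0.01 (del / 5)). assert (He2 := Rmin_r 0.01 (del / 5)).
  assert (He0 : 0 < Rmin 0.01 (del / 5)) by (apply Rmin_glb_lt; lra).
  set (eps := Rmin 0.01 (del / 5)) in *. split; [lra|].
  intros p q r s Hp Hq Hr Hs.
  (* Powers of [1 + eps] are linearised using [eps <= 0.01]; since [eps <= del / 5], the final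
     [3.3 * eps] stays below [del]. *)
  assert (Hr' : r <= (1 + 2.1 * eps) * p) by nra.
  assert (Hs' : s <= (1 + 3.3 * eps) * p) by nra.
  assert (A : forall x, p <= x <= (1 + 3.3 * eps) * p -> Rabs (x / p - 1) < del).
  { intros x Hx. assert (E : x = x / p * p) by (field; lra). set (y := x / p) in *.
    apply Rabs_def1; nra. }
  replace p with (p * 1) by ring. replace q with (p * (q / p)) by (field; lra).
  replace r with (p * (r / p)) by (field; lra). replace s with (p * (s / p)) by (field; lra).
  rewrite tight_gap_scale; try (apply Rdiv_lt_0_compat; lra); try lra.
  apply Rmult_lt_0_compat.
  - apply Rdiv_lt_0_compat; [apply exp_pos|lra].
  - apply H; apply A; nra.
Qed.

(** As [al + 1 < 3/2], a ratio of at most [r^2] changes the power by at most [r^3]. Measuring the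
    ratio by a square keeps all later constants rational. *)
Lemma Rpower_neg_ratio (al x y r : R) : 0 < al < 1 / 2 -> 0 < x -> x <= y -> 1 <= r ->
  y <= r * r * x -> Rpower x (- al - 1) <= r ^ 3 * Rpower y (- al - 1).
Proof.
  intros Hal Hx Hy Hr Hyr.
  assert (E : y = x * (y / x)) by (field; lra).
  assert (Hq : 1 <= y / x) by (apply (proj1 (Rle_div_r _ _ _ Hx)); lra).
  assert (Hq' : y / x <= r * r) by (apply (proj2 (Rle_div_l _ _ _ Hx)); lra).
  set (q := y / x) in *. clearbody q. subst y.
  rewrite <- Rpower_mult_distr by lra.
  assert (E : Rpower q (al + 1) * Rpower q (- al - 1) = 1).
  { rewrite <- Rpower_plus. replace (al + 1 + (- al - 1)) with 0 by ring. apply Rpower_O; lra. }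
  assert (B : Rpower q (al + 1) <= r ^ 3).
  { apply Rle_trans with (Rpower q (3 / 2)); [apply Rle_Rpower; lra|].
    apply Rle_trans with (Rpower (r * r) (3 / 2)); [apply Rle_Rpower_l; lra|].
    rewrite <- Rpower_mult_distr, <- Rpower_plus by lra.
    replace (3 / 2 + 3 / 2) with (INR 3) by (simpl; field). rewrite Rpower_pow by lra. lra. }
  assert (P1 := exp_pos ((- al - 1) * ln x)). fold (Rpower x (- al - 1)) in P1.
  assert (P2 := exp_pos ((- al - 1) * ln q)). fold (Rpower q (- al - 1)) in P2.
  assert (1 <= r ^ 3 * Rpower q (- al - 1)) by nra. nra.
Qed.

Lemma Rpower_neg_succ (al x : R) : 0 < x -> Rpower x (- al) = Rpower x (- al - 1) * x.
Proof. intros Hx. rewrite <- Rpower_succ by lra. f_equal; ring. Qed.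

(** * Comparisons with explicit constants for step ratios up to 1.01 *)

Section Crude.
Variable al : R.
Hypothesis Hal : 0 < al < 0.3738.
Let kap := al * (1 - al).
Let kap_pos : 0 < kap. Proof. unfold kap. nra. Qed.

Lemma Wb_quotient_le (x d e g : R) : 0 < x -> 0 < d -> d <= e -> d <= g ->
  Wb al x d / (d + e) / g <= kap * Rpower x (- al - 1) * (g / 12).
Proof.
  intros Hx Hd He Hg.
  assert (P := Rpower_pos x (- al - 1)).
  destruct (Wb_bounds al ltac:(lra) x d Hx ltac:(lra)) as [_ B]. fold kap in B.
  assert (K : 0 < kap * Rpower x (- al - 1)) by (apply Rmult_lt_0_compat; auto).
  set (k := kap * Rpower x (- al - 1)) in *. 
  apply (proj2 (Rle_div_l _ _ _ (Rlt_le_trans _ _ _ Hd Hg))).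
  apply (proj2 (Rle_div_l _ _ _ (Rplus_lt_0_compat _ _ Hd (Rlt_le_trans _ _ _ Hd He)))).
  apply Rle_trans with (1 := B).
  replace (k * (g / 12) * g * (d + e)) with (k * (g * g * (d + e) / 12)) by field.
  replace (k * d ^ 3 / 6) with (k * (d ^ 3 / 6)) by field.
  apply Rmult_le_compat_l; [lra|].
  assert (d * d <= g * g) by nra. simpl. nra.
Qed.

(** All terms are measured in [kap * e2 * Z], with [Z] taken at the farthest point. The convexity
    gap is at least 1 in this unit and the corrections cost at most [8.25/12] and [1.7/12]. *)
Lemma interior_step (x e1 e2 e3 B1 B3 : R) : 0 < x -> 0 < e1 ->
  e1 <= 1.01 * x -> e1 <= e2 <= 1.01 * e1 -> e2 <= e3 <= 1.01 * e2 ->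
  B1 / e2 <= kap * Rpower x (- al - 1) * (e2 / 12) ->
  B3 / e3 <= kap * Rpower (x + e1 + e2) (- al - 1) * (e3 / 12) ->
  (Wa al (x + e1 + e2) e3 + B3) / e3 <= (Wa al (x + e1) e2 - B1) / e2.
Proof.
  intros Hx He1 H1 H2 H3 HB1 HB3.
  assert (D := Wa_mean_diff al ltac:(lra) (x + e1) e2 e3 ltac:(lra) ltac:(lra) ltac:(lra)).
  fold kap in D. set (y := x + e1 + e2) in *.
  (* The step ratios give [y + e3 <= 4.0605 x] and [y + e3 <= 1.341 y]; 2.02 and 1.17 exceed the
     square roots of these factors, and their cubes are below 8.25 and 1.61. *)
  assert (R1 := Rpower_neg_ratio al x (y + e3) 2.02 ltac:(lra) Hx
    ltac:(unfold y; lra) ltac:(lra) ltac:(unfold y; lra)).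
  assert (R2 := Rpower_neg_ratio al y (y + e3) 1.17 ltac:(lra) ltac:(unfold y; lra)
    ltac:(lra) ltac:(lra) ltac:(unfold y; lra)).
  assert (P := Rpower_pos (y + e3) (- al - 1)).
  set (Z := Rpower (y + e3) (- al - 1)) in *.
  assert (HB1' : B1 / e2 <= kap * e2 * Z * (8.25 / 12)).
  { apply Rle_trans with (1 := HB1).
    replace (kap * Rpower x (- al - 1) * (e2 / 12)) with (kap * e2 * (Rpower x (- al - 1) / 12)) by field.
    replace (kap * e2 * Z * (8.25 / 12)) with (kap * e2 * (8.25 * Z / 12)) by field.
    apply Rmult_le_compat_l; [nra|]. lra. }
  assert (HB3' : B3 / e3 <= kap * e2 * Z * (1.7 / 12)).
  { apply Rle_trans with (1 := HB3).
    apply Rle_trans with (kap * (1.61 * Z) * (1.01 * e2 / 12)).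
    - apply Rmult_le_compat; [|lra| |lra].
      + apply Rmult_le_pos; [lra|left; apply Rpower_pos].
      + apply Rmult_le_compat_l; lra.
    - replace (kap * (1.61 * Z) * (1.01 * e2 / 12)) with (kap * e2 * Z * (1.61 * 1.01 / 12)) by field.
      apply Rmult_le_compat_l; [|lra]. apply Rmult_le_pos; nra. }
  assert (0 < kap * e2 * Z) by (apply Rmult_lt_0_compat; nra).
  rewrite RIneq.Rdiv_plus_distr, RIneq.Rdiv_minus_distr. lra.
Qed.

Lemma last_step (p q B : R) : 0 < p -> p <= q <= 1.01 * p ->
  B / q <= kap * Rpower p (- al - 1) * (q / 12) ->
  (Wa al p q + B) / q <= Wa al 0 p / p.
Proof.
  intros Hp Hq HB.
  assert (D := Wa_mean_diff al ltac:(lra) 0 p q ltac:(lra) ltac:(lra) ltac:(lra)).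
  fold kap in D. rewrite !Rplus_0_l in D.
  (* Here [p + q <= 2.01 p], and [1.5^3 < 3.4]; the correction costs at most [3.5/12] of the gap. *)
  assert (R1 := Rpower_neg_ratio al p (p + q) 1.5 ltac:(lra) Hp ltac:(lra) ltac:(lra) ltac:(lra)).
  assert (P := Rpower_pos (p + q) (- al - 1)).
  set (Z := Rpower (p + q) (- al - 1)) in *.
  assert (HB' : B / q <= kap * p * Z * (3.5 / 12)).
  { apply Rle_trans with (1 := HB).
    apply Rle_trans with (kap * (3.4 * Z) * (1.01 * p / 12)).
    - apply Rmult_le_compat; [|lra| |lra].
      + apply Rmult_le_pos; [lra|left; apply Rpower_pos].
      + apply Rmult_le_compat_l; lra.
    - replace (kap * (3.4 * Z) * (1.01 * p / 12)) with (kap * p * Z * (3.4 * 1.01 / 12)) by field.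
      apply Rmult_le_compat_l; [|lra]. apply Rmult_le_pos; nra. }
  assert (0 < kap * p * Z) by (apply Rmult_lt_0_compat; nra).
  rewrite RIneq.Rdiv_plus_distr. lra.
Qed.

(** The mean of [Wa] is at least [(1 - al) (x+d)^(-al)], and [1 - al - 0.2 >= al / 3] in the given
    range. The factor [al / 3] is the one that produces [3 Gamma(2-al) / al] in the final
    constant. *)
Lemma first_coef_lower (x d B : R) : 0 <= x -> 0 < d ->
  B / d <= 0.2 * Rpower (x + d) (- al) ->
  al / 3 * Rpower (x + d) (- al) <= (Wa al x d - B) / d.
Proof.
  intros Hx Hd HB. assert (D := Wa_mean_ge al ltac:(lra) x d Hx Hd).
  assert (P := Rpower_pos (x + d) (- al)).
  rewrite RIneq.Rdiv_minus_distr. nra.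
Qed.

Lemma first_coef_correction (x e1 e2 : R) : 0 < x -> 0 < e1 -> e1 <= 1.01 * x ->
  e1 <= e2 <= 1.01 * e1 ->
  Wb al x e1 / (e1 + e2) / e2 <= 0.2 * Rpower (x + e1 + e2) (- al).
Proof.
  intros Hx He1 H1 H2.
  assert (B := Wb_quotient_le x e1 e2 e2 Hx He1 ltac:(lra) ltac:(lra)).
  assert (R1 := Rpower_neg_ratio al x (x + e1 + e2) 1.75 ltac:(lra) Hx ltac:(lra) ltac:(lra) ltac:(lra)).
  rewrite Rpower_neg_succ by lra.
  assert (P := Rpower_pos (x + e1 + e2) (- al - 1)).
  set (Z := Rpower (x + e1 + e2) (- al - 1)) in *.
  apply Rle_trans with (1 := B).
  apply Rle_trans with (0.25 * (5.4 * Z) * ((x + e1 + e2) / 12)).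
  - apply Rmult_le_compat; [|lra| |lra].
    + apply Rmult_le_pos; [lra|left; apply Rpower_pos].
    + apply Rmult_le_compat; [lra|left; apply Rpower_pos|unfold kap; nra|lra].
  - assert (0 < Z * (x + e1 + e2)) by (apply Rmult_lt_0_compat; lra). lra.
Qed.

Lemma first_coef_correction_2 (e1 e2 : R) : 0 < e1 -> e1 <= e2 <= 1.01 * e1 ->
  Wb al 0 e1 / (e1 + e2) / e2 <= 0.2 * Rpower (e1 + e2) (- al).
Proof.
  intros He1 H2. rewrite Wb_zero by lra.
  assert (R1 := Rpower_neg_ratio al e1 (e1 + e2) 1.42 ltac:(lra) He1 ltac:(lra) ltac:(lra) ltac:(lra)).
  rewrite (Rpower_neg_succ al (e1 + e2)) by lra.
  assert (P := Rpower_pos (e1 + e2) (- al - 1)).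
  set (Z := Rpower (e1 + e2) (- al - 1)) in *.
  assert (E : Rpower e1 (2 - al) = Rpower e1 (- al - 1) * e1 ^ 3).
  { rewrite <- (Rpower_pow 3) by lra. rewrite <- Rpower_plus. f_equal. simpl. ring. }
  rewrite E.
  (* At distance 0 the exact value of [Wb] replaces the cubic bound. With [1.42^3 < 2.87] the
     requirement becomes [0.23 * 2.87 <= 0.2 * 4]. *)
  assert (C : al / (2 - al) <= 0.23) by (apply (proj2 (Rle_div_l al 0.23 (2 - al) ltac:(lra))); lra).
  assert (C0 : 0 <= al / (2 - al)) by (apply Rdiv_le_0_compat; lra).
  apply (proj2 (Rle_div_l _ _ e2 ltac:(lra))).
  apply (proj2 (Rle_div_l _ _ (e1 + e2) ltac:(lra))).
  assert (E3 : 0 < e1 ^ 3) by (apply pow_lt; lra).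
  apply Rle_trans with (0.23 * (2.87 * Z * e1 ^ 3)).
  - apply Rmult_le_compat; [lra| |lra|].
    + apply Rmult_le_pos; [left; apply Rpower_pos|lra].
    + apply Rmult_le_compat_r; lra.
  - replace (0.2 * (Z * (e1 + e2)) * e2 * (e1 + e2)) with (Z * (0.2 * ((e1 + e2) * (e1 + e2) * e2))) by ring.
    replace (0.23 * (2.87 * Z * e1 ^ 3)) with (Z * (0.6601 * e1 ^ 3)) by lra.
    apply Rmult_le_compat_l; [lra|].
    assert (4 * (e1 * e1) <= (e1 + e2) * (e1 + e2)) by nra.
    assert (0 < e1 * e1) by nra.
    assert (4 * (e1 * e1) * e1 <= (e1 + e2) * (e1 + e2) * e2) by (apply Rmult_le_compat; nra).
    simpl. nra.
Qed.
End Crude.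

(** * Coefficients on the logarithmic grid *)

Lemma ln_le_sub_1 (y : R) : 0 < y -> ln y <= y - 1.
Proof. intros Hy. assert (H := exp_ineq1_le (ln y)). rewrite exp_ln in H; lra. Qed.

Lemma ln_ge_1_sub_inv (y : R) : 0 < y -> 1 - / y <= ln y.
Proof.
  intros Hy. assert (H := ln_le_sub_1 (/ y) (Rinv_0_lt_compat _ Hy)).
  rewrite ln_Rinv in H by lra. lra.
Qed.

Section Grid.
Variables (al a T eps : R) (N : nat).
Hypothesis Hal : 0 < al < 0.3738.
Hypothesis Ha : 0 < a.
Hypothesis HT : a < T.
Hypothesis HN : (0 < N)%nat.
Let tau := (T - a) / INR N.
Hypothesis Heps : 0 < eps <= 0.01.
Hypothesis Htau : 2 * tau / a <= eps.
Hypothesis Htight : forall p q r s, 0 < p ->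
    p <= q <= (1 + eps) * p -> q <= r <= (1 + eps) * q -> r <= s <= (1 + eps) * r ->
    0 < tight_gap al p q r s.
Let t := tgrid a T N.

Definition lstep (i : nat) : R := ln (t i / t (i - 1)).
Definition ldist (i k : nat) : R := ln (t k / t i).

Lemma tau_pos : 0 < tau.
Proof. apply Rdiv_lt_0_compat; [lra|]. now apply lt_0_INR. Qed.

Lemma tgrid_ge (k : nat) : a <= t k.
Proof.
  unfold t, tgrid. fold tau. assert (H := tau_pos). assert (P := pos_INR k). nra.
Qed.

Lemma tgrid_succ (k : nat) : t (S k) = t k + tau.
Proof. unfold t, tgrid. fold tau. rewrite S_INR. ring. Qed.

Lemma ldist_add (i j k : nat) : ldist i k = ldist j k + ldist i j.
Proof.
  assert (Hi := tgrid_ge i). assert (Hj := tgrid_ge j). assert (Hk := tgrid_ge k).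
  unfold ldist. rewrite !ln_div by lra. ring.
Qed.

Lemma ldist_refl (k : nat) : ldist k k = 0.
Proof.
  assert (Hk := tgrid_ge k). unfold ldist.
  rewrite ln_div by lra. ring.
Qed.

Lemma ldist_succ (i k : nat) : ldist i k = ldist (S i) k + lstep (S i).
Proof.
  rewrite (ldist_add i (S i) k). unfold lstep, ldist. now rewrite Nat.sub_succ, Nat.sub_0_r.
Qed.

Lemma lstep_succ_bounds (i : nat) : tau / t (S i) <= lstep (S i) <= tau / t i.
Proof.
  assert (Hi := tgrid_ge i). assert (Hi' := tgrid_ge (S i)). assert (Hs := tgrid_succ i).
  unfold lstep. rewrite Nat.sub_succ, Nat.sub_0_r.
  assert (Hp : 0 < t (S i) / t i) by (apply Rdiv_lt_0_compat; lra).
  assert (H1 := ln_le_sub_1 _ Hp). assert (H2 := ln_ge_1_sub_inv _ Hp).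
  replace (t (S i) / t i - 1) with (tau / t i) in H1 by (rewrite Hs; field; lra).
  replace (1 - / (t (S i) / t i)) with (tau / t (S i)) in H2
    by (replace tau with (t (S i) - t i) by lra; field; lra).
  lra.
Qed.

Lemma lstep_pos (i : nat) : (1 <= i)%nat -> 0 < lstep i.
Proof.
  intros Hi. destruct i as [|i]; [lia|].
  destruct (lstep_succ_bounds i) as [H _]. assert (Hp := tgrid_ge (S i)).
  assert (0 < tau / t (S i)) by (apply Rdiv_lt_0_compat; [apply tau_pos|lra]). lra.
Qed.

(** The lower bound is log-concavity of an arithmetic progression. For the upper one, steps [i] and
    [i+1] lie below [tau / t_(i-1)] and above [tau / t_(i+1)], so their ratio is at most
    [1 + 2 tau / t_(i-1) <= 1 + 2 tau / a]. *)
Lemma lstep_ratio (i : nat) : (1 <= i)%nat ->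
  lstep (S i) <= lstep i <= (1 + eps) * lstep (S i).
Proof.
  intros Hi. destruct i as [|i]; [lia|]. assert (Hp := tau_pos).
  assert (H1 := tgrid_ge i). assert (S1 := tgrid_succ i). assert (S2 := tgrid_succ (S i)).
  split.
  - unfold lstep. rewrite !Nat.sub_succ, !Nat.sub_0_r.
    apply ln_le; [apply Rdiv_lt_0_compat; lra|].
    apply (proj2 (Rle_div_l _ _ (t (S i)) ltac:(lra))).
    apply Rmult_le_reg_r with (t i); [lra|].
    replace (t (S i) / t i * t (S i) * t i) with (t (S i) * t (S i)) by (field; lra). nra.
  - destruct (lstep_succ_bounds i) as [_ B1]. destruct (lstep_succ_bounds (S i)) as [B2 _].
    apply Rle_trans with (1 := B1).
    apply Rle_trans with ((1 + eps) * (tau / t (S (S i)))); [|apply Rmult_le_compat_l; lra].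
    apply (proj2 (Rle_div_l _ _ (t i) ltac:(lra))).
    replace ((1 + eps) * (tau / t (S (S i))) * t i) with (tau * ((1 + eps) * t i / t (S (S i))))
      by (field; lra).
    rewrite <- (Rmult_1_r tau) at 1. apply Rmult_le_compat_l; [lra|].
    apply (proj1 (Rle_div_r _ _ (t (S (S i))) ltac:(lra))).
    assert (2 * tau <= eps * a) by (apply (proj1 (Rle_div_l _ _ a Ha)); exact Htau).
    nra.
Qed.

(* This is [-b_(i,k)], extended by [0] to [i = 1] and [i > k]. *)
Definition bcorr (i k : nat) : R :=
  if orb (i =? 1)%nat (k <? i)%nat then 0
  else Wb al (ldist i k) (lstep i) / (lstep i + lstep (i - 1)).

Lemma ldist_nonneg (i k : nat) : (i <= k)%nat -> 0 <= ldist i k.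
Proof.
  intros H. induction H as [|k H IH]; [rewrite ldist_refl; lra|].
  rewrite (ldist_add i k). assert (P := lstep_pos (S k) ltac:(lia)).
  assert (E := ldist_succ k (S k)). rewrite ldist_refl in E. lra.
Qed.

Lemma bcorr_first (k : nat) : bcorr 1 k = 0.
Proof. reflexivity. Qed.

Lemma bcorr_out (i k : nat) : (k < i)%nat -> bcorr i k = 0.
Proof.
  intros H. unfold bcorr. apply Nat.ltb_lt in H. rewrite H, Bool.orb_true_r. reflexivity.
Qed.

Lemma bcorr_in (i k : nat) : (2 <= i <= k)%nat ->
  bcorr i k = Wb al (ldist i k) (lstep i) / (lstep i + lstep (i - 1)).
Proof.
  intros H. unfold bcorr.
  destruct (Nat.eqb_spec i 1); [lia|]. destruct (Nat.ltb_spec k i); [lia|]. reflexivity.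
Qed.

Lemma bcorr_nonneg (i k : nat) : (1 <= i)%nat -> 0 <= bcorr i k.
Proof.
  intros Hi. destruct (Nat.eq_dec i 1) as [->|H1]; [rewrite bcorr_first; lra|].
  destruct (le_lt_dec i k) as [Hk|Hk]; [|rewrite bcorr_out by lia; lra].
  rewrite bcorr_in by lia.
  assert (P1 := lstep_pos i Hi). assert (P2 := lstep_pos (i - 1) ltac:(lia)).
  apply Rdiv_le_0_compat; [|lra]. apply Wb_nonneg; [lra|now apply ldist_nonneg|lra].
Qed.

Lemma a_coef_eq (i k : nat) : (1 <= i)%nat ->
  a_coef al a T N i k = Wa al (ldist i k) (lstep i).
Proof.
  intros Hi. destruct i as [|i]; [lia|].
  unfold Wa. rewrite <- ldist_succ. unfold a_coef, ldist.
  now rewrite Nat.sub_succ, Nat.sub_0_r.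
Qed.

Lemma b_coef_eq (i k : nat) : (2 <= i <= k)%nat -> b_coef al a T N i k = - bcorr i k.
Proof.
  intros Hi. rewrite bcorr_in by lia. destruct i as [|[|i]]; [lia|lia|].
  assert (P1 := lstep_pos (S (S i)) ltac:(lia)). assert (P2 := lstep_pos (S i) ltac:(lia)).
  unfold Wb. rewrite <- ldist_succ. unfold b_coef. fold t.
  replace (S (S i) - 1)%nat with (S i) by lia. replace (S (S i) - 2)%nat with i by lia.
  fold (ldist i (S (S i))). fold (ldist (S i) (S (S i))). fold (ldist (S (S i)) k). fold (ldist (S i) k).
  rewrite (ldist_succ i (S (S i))), (ldist_succ (S i) (S (S i))), ldist_refl, !Rplus_0_l.
  field. lra.
Qed.

(** The zero extension of [bcorr] merges the four cases of the definition into one formula. *)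
Lemma c_coef_eq (i k : nat) : (1 <= i <= k)%nat ->
  c_coef al a T N i k
  = (Wa al (ldist i k) (lstep i) + bcorr i k - bcorr (S i) k) / lstep i / Gamma (2 - al).
Proof.
  intros Hi. assert (HG : 0 < Gamma (2 - al)) by (apply Gamma_pos_1_2; lra).
  assert (P := lstep_pos i ltac:(lia)).
  unfold c_coef. fold t.
  destruct (Nat.eqb_spec k 1) as [->|Hk].
  - replace i with 1%nat in * by lia. rewrite a_coef_eq, bcorr_first, bcorr_out by lia.
    change (ln (t 1%nat / t 0%nat)) with (lstep 1). field. lra.
  - destruct (Nat.eqb_spec i 1) as [->|Hi1].
    + rewrite a_coef_eq, b_coef_eq, bcorr_first by lia.
      change (ln (t 1%nat / t 0%nat)) with (lstep 1). field. lra.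
    + destruct (Nat.eqb_spec i k) as [->|Hik].
      * rewrite a_coef_eq, b_coef_eq, (bcorr_out (S k)) by lia.
        fold (lstep k). field. lra.
      * rewrite a_coef_eq, !b_coef_eq by lia. fold (lstep i). field. lra.
Qed.

Lemma bcorr_quotient_le (i k : nat) (g : R) : (1 <= i)%nat -> (i < k)%nat -> lstep i <= g ->
  bcorr i k / g <= al * (1 - al) * Rpower (ldist i k) (- al - 1) * (g / 12).
Proof.
  intros Hi Hk Hg. assert (P := lstep_pos i Hi).
  destruct (Nat.eq_dec i 1) as [->|H1].
  - rewrite bcorr_first. unfold Rdiv at 1. rewrite Rmult_0_l.
    apply Rmult_le_pos; [|lra]. apply Rmult_le_pos; [nra|left; apply Rpower_pos].
  - rewrite bcorr_in by lia.
    destruct (lstep_ratio (i - 1) ltac:(lia)) as [R1 _]. replace (S (i - 1)) with i in R1 by lia.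
    apply Wb_quotient_le; auto.
    rewrite ldist_succ. assert (H := ldist_nonneg (S i) k Hk).
    assert (Q := lstep_pos (S i) ltac:(lia)). lra.
Qed.

Lemma c_coef_mono (i n : nat) : (1 <= i)%nat -> (i < n)%nat ->
  c_coef al a T N i n <= c_coef al a T N (S i) n.
Proof.
  intros Hi Hn. rewrite !c_coef_eq by lia.
  assert (HG : 0 < Gamma (2 - al)) by (apply Gamma_pos_1_2; lra).
  apply Rmult_le_compat_r; [left; now apply Rinv_0_lt_compat|].
  assert (P0 := lstep_pos i Hi). assert (P1 := lstep_pos (S i) ltac:(lia)).
  assert (P2 := lstep_pos (S (S i)) ltac:(lia)).
  assert (Q0 := lstep_ratio i Hi). assert (Q1 := lstep_ratio (S i) ltac:(lia)).
  assert (Q2 := lstep_ratio (S (S i)) ltac:(lia)).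
  assert (B := bcorr_nonneg (S i) n ltac:(lia)).
  rewrite (ldist_succ i n).
  (* The shared correction lowers the left coefficient and raises the right one, so the comparison
     without it is stronger. *)
  assert (Hdrop : forall A0 B0 A1 B2, (A0 + B0) / lstep i <= (A1 - B2) / lstep (S i) ->
    (A0 + B0 - bcorr (S i) n) / lstep i <= (A1 + bcorr (S i) n - B2) / lstep (S i)).
  { intros A0 B0 A1 B2 H.
    assert (0 <= bcorr (S i) n / lstep i) by (apply Rdiv_le_0_compat; lra).
    assert (0 <= bcorr (S i) n / lstep (S i)) by (apply Rdiv_le_0_compat; lra).
    unfold Rdiv in *. lra. }
  destruct (Nat.eq_dec (S i) n) as [<-|H1].
  - rewrite ldist_refl, Rplus_0_l. apply Hdrop. rewrite (bcorr_out (S (S i))) by lia.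
    rewrite Rminus_0_r. apply last_step; auto; [nra|].
    assert (E := ldist_succ i (S i)). rewrite ldist_refl, Rplus_0_l in E. rewrite <- E.
    apply bcorr_quotient_le; lia || lra.
  - rewrite (ldist_succ (S i) n).
    destruct (Nat.eq_dec (S (S i)) n) as [<-|H2].
    + rewrite ldist_refl, Rplus_0_l.
      set (p := lstep (S (S i))) in *. set (q := lstep (S i)) in *. set (r := lstep i) in *.
      (* For [i = 1] no step precedes [r] and the correction is 0; the fictitious step [s = r] then
         fits the pattern of [tight_gap]. *)
      assert (Hs : exists s, r <= s <= (1 + eps) * r /\
        bcorr i (S (S i)) <= Wb al (p + q) r / (r + s)).
      { destruct (Nat.eq_dec i 1) as [->|Hi1].
        - exists r. split; [nra|]. rewrite bcorr_first. apply Rdiv_le_0_compat; [|lra].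
          apply Wb_nonneg; lra.
        - exists (lstep (i - 1)). assert (R := lstep_ratio (i - 1) ltac:(lia)).
          replace (S (i - 1)) with i in R by lia. split; [exact R|].
          rewrite bcorr_in by lia. right. do 2 f_equal.
          rewrite (ldist_succ i), (ldist_succ (S i)), ldist_refl. fold p q. ring. }
      destruct Hs as [s [Hs1 Hs2]].
      assert (G := Htight p q r s P2 Q1 Q0 Hs1). unfold tight_gap in G.
      rewrite (bcorr_in (S i)), (bcorr_in (S (S i))), ldist_refl by lia.
      replace (S i - 1)%nat with i by lia. replace (S (S i) - 1)%nat with (S i) by lia.
      rewrite (ldist_succ (S i)), ldist_refl, Rplus_0_l. fold p q r.
      apply Rle_trans with
        ((Wa al (p + q) r + Wb al (p + q) r / (r + s) - Wb al p q / (q + r)) / r); [|lra].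
      apply Rmult_le_compat_r; [left; now apply Rinv_0_lt_compat|lra].
    + apply Hdrop.
      (* At least one more step separates the point from [t_n], so the distance [x] is comparable to
         the steps and [e1 <= 1.01 * x] holds. *)
      assert (X0 : lstep (S (S (S i))) <= ldist (S (S i)) n).
      { rewrite (ldist_succ (S (S i)) n). assert (H := ldist_nonneg (S (S (S i))) n ltac:(lia)). lra. }
      assert (P3 := lstep_pos (S (S (S i))) ltac:(lia)).
      apply interior_step; try lra.
      * nra.
      * nra.
      * nra.
      * apply (bcorr_quotient_le (S (S i)) n (lstep (S i))); lia || lra.
      * rewrite <- !ldist_succ. apply bcorr_quotient_le; lia || lra.
Qed.

(** The correction [B_2] is absent for [n = 1], sits at distance 0 for [n = 2], and obeys the cubic
    bound from [n = 3] on. *)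
Lemma c_coef_first_lower (n : nat) : (1 <= n)%nat ->
  al / 3 * Rpower (ldist 0 n) (- al) / Gamma (2 - al) <= c_coef al a T N 1 n.
Proof.
  intros Hn. rewrite c_coef_eq by lia.
  assert (HG : 0 < Gamma (2 - al)) by (apply Gamma_pos_1_2; lra).
  apply Rmult_le_compat_r; [left; now apply Rinv_0_lt_compat|].
  assert (P1 := lstep_pos 1 ltac:(lia)). assert (P2 := lstep_pos 2 ltac:(lia)).
  assert (Q1 := lstep_ratio 1 ltac:(lia)).
  rewrite bcorr_first, Rplus_0_r, (ldist_succ 0 n).
  apply first_coef_lower; auto; [now apply ldist_nonneg|].
  destruct (Nat.eq_dec n 1) as [->|H1].
  - rewrite bcorr_out by lia. unfold Rdiv. rewrite Rmult_0_l.
    assert (P := Rpower_pos (ldist 1 1 + lstep 1) (- al)). lra.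
  - rewrite bcorr_in by lia. rewrite (ldist_succ 1 n). change (2 - 1)%nat with 1%nat.
    destruct (Nat.eq_dec n 2) as [->|H2].
    + rewrite ldist_refl, Rplus_0_l. apply first_coef_correction_2; auto; nra.
    + assert (X0 : lstep 3 <= ldist 2 n).
      { rewrite (ldist_succ 2 n). assert (H := ldist_nonneg 3 n ltac:(lia)). lra. }
      assert (P3 := lstep_pos 3 ltac:(lia)). assert (Q2 := lstep_ratio 2 ltac:(lia)).
      apply first_coef_correction; auto; nra.
Qed.

Lemma c_coef_first_pos (n : nat) : (1 <= n)%nat -> 0 < c_coef al a T N 1 n.
Proof.
  intros Hn. eapply Rlt_le_trans; [|now apply c_coef_first_lower].
  apply Rdiv_lt_0_compat; [|apply Gamma_pos_1_2; lra].
  apply Rmult_lt_0_compat; [lra|apply Rpower_pos].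
Qed.

Lemma ldist_0_le (n : nat) : (1 <= n)%nat -> 0 < ldist 0 n <= INR n * tau / a.
Proof.
  intros Hn. assert (Hp := tau_pos). split.
  - rewrite (ldist_succ 0 n). assert (H := ldist_nonneg 1 n Hn).
    assert (P := lstep_pos 1 ltac:(lia)). lra.
  - unfold ldist. assert (Hnn := tgrid_ge n). assert (E0 : t 0%nat = a) by (unfold t, tgrid; simpl; ring).
    assert (H := ln_le_sub_1 (t n / t 0%nat)). rewrite E0 in *.
    replace (t n / a - 1) with (INR n * tau / a) in H by (unfold t, tgrid; fold tau; field; lra).
    apply H. apply Rdiv_lt_0_compat; lra.
Qed.

(** Since [ln (t_n / a) <= n tau / a], the lower bound on [c_(1,n)] becomes a multiple of
    [(n tau / a)^(-al)]. Multiplied by [(n tau)^al] it leaves [a^al], and the stated [C] is the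
    reciprocal of what remains. *)
Lemma c_coef_weight (C : R) (n : nat) : (1 <= n)%nat ->
  3 * Gamma (2 - al) / (al * Rpower a al) <= C ->
  1 <= c_coef al a T N 1 n * (C * Rpower (INR n * tau) al).
Proof.
  intros Hn HC. assert (HG : 0 < Gamma (2 - al)) by (apply Gamma_pos_1_2; lra).
  assert (Hl := ldist_0_le n Hn). assert (Hp := tau_pos).
  assert (Hnt : 0 < INR n * tau) by (apply Rmult_lt_0_compat; [apply lt_0_INR; lia|lra]).
  assert (HB := c_coef_first_lower n Hn).
  assert (HD := Rpower_decr (ldist 0 n) (INR n * tau / a) (- al) (proj1 Hl) (proj2 Hl) ltac:(lra)).
  assert (E : Rpower (INR n * tau / a) (- al) * Rpower (INR n * tau) al = Rpower a al).
  { unfold Rdiv. rewrite <- Rpower_mult_distr by (auto; now apply Rinv_0_lt_compat).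
    assert (E1 : Rpower (INR n * tau) (- al) * Rpower (INR n * tau) al = 1).
    { rewrite <- Rpower_plus, Rplus_opp_l. now apply Rpower_O. }
    assert (E2 : Rpower (/ a) (- al) = Rpower a al).
    { unfold Rpower. rewrite ln_Rinv by lra. f_equal. ring. }
    rewrite E2. transitivity (Rpower a al * (Rpower (INR n * tau) (- al) * Rpower (INR n * tau) al)); [ring|].
    rewrite E1. ring. }
  assert (PA := Rpower_pos a al). assert (PX := Rpower_pos (INR n * tau) al).
  set (K := 3 * Gamma (2 - al) / (al * Rpower a al)) in *.
  assert (HK : 0 < K) by (apply Rdiv_lt_0_compat; nra).
  apply Rle_trans with (al / 3 * Rpower (INR n * tau / a) (- al) / Gamma (2 - al)
     * (K * Rpower (INR n * tau) al)).
  - right. transitivity (al / 3 / Gamma (2 - al) * K *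
      (Rpower (INR n * tau / a) (- al) * Rpower (INR n * tau) al)); [|field; lra].
    rewrite E. unfold K. field. lra.
  - assert (PN := Rpower_pos (INR n * tau / a) (- al)).
    apply Rmult_le_compat.
    + apply Rdiv_le_0_compat; [|lra]. apply Rmult_le_pos; lra.
    + apply Rmult_le_pos; lra.
    + apply Rle_trans with (2 := HB). apply Rmult_le_compat_r; [left; now apply Rinv_0_lt_compat|].
      apply Rmult_le_compat_l; lra.
    + apply Rmult_le_compat_r; lra.
Qed.
End Grid.

(** * Choice of the step threshold and the resulting estimate *)

Lemma fold_right_Rmax_scal {A : Type} (C : R) (g : A -> R) (l : list A) : 0 <= C ->
  fold_right Rmax 0 (map (fun k => C * g k) l) = C * fold_right Rmax 0 (map g l).
Proof.
  intros HC. induction l as [|x l IH]; simpl; [ring|]. now rewrite IH, RmaxRmult.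
Qed.

Theorem theorem4p3 (al be a T L : R) :
  0 < al < 0.3738 -> 1 < be < 2 -> 0 < a -> a < T -> 0 < L ->
  exists tau0 h0 : R, 0 < tau0 /\ 0 < h0 /\
  forall (N M : nat) (f : R -> R -> R -> R) (u0 : R -> R -> R)
         (U : nat -> nat -> nat -> R),
    (0 < N)%nat -> (0 < M)%nat ->
    (T - a) / INR N <= tau0 -> 2 * L / INR M <= h0 ->
    is_L12_solution al be a T L N M f u0 U ->
    let tau := (T - a) / INR N in
    let h := 2 * L / INR M in
    let x := fun j : nat => - L + INR j * h in
    let F := fun (n j k : nat) => f (x j) (x k) (tgrid a T N n) in
    let C := Rmax (6 * Gamma (1 - al) / Rpower a al)
                  (3 * Gamma (2 - al) / (al * Rpower a al)) in
    forall n : nat, (1 <= n <= N)%nat ->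
      norm_h h M (U n) <=
      norm_h h M (U 0%nat)
      + C * fold_right Rmax 0
              (map (fun k => Rpower (INR k * tau) al * norm_h h M (F k))
                   (seq 1 n)).
Proof.
  intros Hal Hbe Ha HT HL.
  destruct (tight_gap_pos al Hal) as [eps [Heps Htight]].
  (* [tau <= eps * a / 2] is the condition [2 tau / a <= eps] that controls the ratios of
     logarithmic steps. *)
  exists (eps * a / 2), 1. split; [|split; [lra|]].
  { assert (0 < eps * a) by (apply Rmult_lt_0_compat; lra). lra. }
  intros N M f u0 U HN HM Htau _ HU tau h x F C n Hn. fold tau in Htau.
  assert (Htau' : 2 * tau / a <= eps) by (apply (proj2 (Rle_div_l _ _ a Ha)); lra).
  assert (HC : 3 * Gamma (2 - al) / (al * Rpower a al) <= C) by apply Rmax_r.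
  assert (HC0 : 0 <= C).
  { apply Rle_trans with (2 := HC). left. apply Rdiv_lt_0_compat.
    - assert (0 < Gamma (2 - al)) by (apply Gamma_pos_1_2; lra). lra.
    - apply Rmult_lt_0_compat; [lra|apply Rpower_pos]. }
  (* The constant moves inside the maximum so that [C (k tau)^al] can act as the weight [g k] of
     [stability_bound]. *)
  rewrite <- fold_right_Rmax_scal by exact HC0.
  rewrite (map_ext _ (fun k => (C * Rpower (INR k * tau) al) * norm_h h M (F k)))
    by (intros; ring).
  apply (stability_bound al be a T L N M f u0 U ltac:(lra) HU).
  - intros k Hk. apply (c_coef_first_pos al a T eps N); auto; lia.
  - intros i k Hi Hk. apply (c_coef_mono al a T eps N); auto; lia.
  - intros k Hk. apply (c_coef_weight al a T eps N); auto; lia.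
  - exact Hn.
Qed.
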